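(* Let $2<n<\omega$. Then $\Psi(n,n+3)_f$ holds. Consequently, for every $m\geq n+3$, $\Psi(n,m)_f$ holds.
   Context: $L_n$ is first-order logic restricted to the variables $x_0,\dots,x_{n-1}$ (relational signature). For a countable $L_n$ theory $T$, $\mathfrak{Fm}_T$ is its Tarski–Lindenbaum algebra, a cylindric algebra of dimension $n$ ($c_i$ interprets $\exists x_i$, $d_{ij}$ interprets $x_i=x_j$). $T$ is atomic if $\mathfrak{Fm}_T$ is atomic as a Boolean algebra, and complete if $\mathfrak{Fm}_T$ is simple. The type of co-atoms is $\Gamma=\{\varphi:\varphi/T \text{ is a co-atom of } \mathfrak{Fm}_T\}$. Relativized representations: for $\mathfrak A\in\mathsf{CA}_n$, a relativized representation is an injective homomorphism $f$ from $\mathfrak A$ into the algebra $\wp(V)$, $V\subseteq{}^nM$, $M=\bigcup_{s\in V}\mathrm{rng}(s)$, with cylindric operations relativized to $V$. An $n$-clique is $C\subseteq M$ with $(a_0,\dots,a_{n-1})\in V$ for all $a_0,\dots,a_{n-1}\in C$; $\mathsf C^m(M)=\{s\in{}^mM:\mathrm{rng}(s)\text{ is an }n\text{-clique}\}$. For $s,t$ sequences, $t\equiv_i s$ means $t(j)=s(j)$ for $j\ne i$. Let $\mathcal L(\mathfrak A)^m$ be the first-order language with variables $x_0,\dots,x_{m-1}$ and an $n$-ary relation symbol for each $a\in A$, interpreted at $s\in\mathsf C^m(M)$ by: $a(x_{l(0)},\dots,x_{l(n-1)})$ holds iff $(s_{l(0)},\dots,s_{l(n-1)})\in f(a)$; Boolean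 connectives as usual; $\exists x_i\varphi$ holds at $s$ iff $\varphi$ holds at some $t\in\mathsf C^m(M)$ with $t\equiv_i s$ (clique-guarded semantics). $M$ is $m$-square if for all $s\in\mathsf C^m(M)$, $a\in A$, $i<n$ and injective $l:n\to m$, whenever $(s_{l(0)},\dots,s_{l(n-1)})\in f(c_ia)$ there is $t\in\mathsf C^m(M)$ with $t\equiv_i s$ and $(t_{l(0)},\dots,t_{l(n-1)})\in f(a)$. $M$ is $m$-flat if it is $m$-square and for every $\varphi\in\mathcal L(\mathfrak A)^m$, $s\in\mathsf C^m(M)$ and distinct $i,j<m$, $\exists x_i\exists x_j\varphi\leftrightarrow\exists x_j\exists x_i\varphi$ holds at $s$. An $m$-square (resp. $m$-flat) model of $T$ is an $m$-square (resp. $m$-flat) representation of $\mathfrak{Fm}_T$; $\Gamma$ is realized in it if $\bigcap_{\varphi\in\Gamma}f(\varphi/T)\ne\emptyset$. A formula $\psi$ (in the signature of $T$, possibly using more than $n$ variables) isolates $\Gamma$ if $\psi$ is consistent with $T$ and $T\models\psi\to\varphi$ for all $\varphi\in\Gamma$. For $n\le l<m\le\omega$, $\Psi(l,m)_f$ is the statement: there is a countable, atomic and complete $L_n$ theory $T$ such that $\Gamma$ is realized in every $m$-flat model of $T$, but every formula isolating $\Gamma$ uses more than $l$ variables. *)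

(* Defs.v *)
From HB Require Import structures.
From mathcomp Require Import all_boot all_order.
From mathcomp Require Import boolp classical_sets functions cardinality.

Set Implicit Arguments.
Unset Strict Implicit.
Unset Printing Implicit Defensive.

Import Order.TTheory.
Local Open Scope classical_set_scope.
Local Open Scope quotient_scope.

Record signature := Signature {
  rel_symb :> Type;
  arity : rel_symb -> nat }.

(* L_n-formulas are [fmla S 'I_n]; formulas with no bound on their variables
   are [fmla S nat]. *)
Inductive fmla (S : signature) (X : Type) : Type :=
| Rel (r : S) of 'I_(arity r) -> X
| Eq of X & X
| Bot
| Neg of fmla S X
| And of fmla S X & fmla S X
| Ex of X & fmla S X.

Arguments Rel {S X} r _.
Arguments Eq {S X} _ _.
Arguments Bot {S X}.

Section Connectives.
Variables (S : signature) (X : Type).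
Implicit Types phi psi : fmla S X.
Definition Top : fmla S X := Neg Bot.
Definition Or phi psi := Neg (And (Neg phi) (Neg psi)).
Definition Imp phi psi := Neg (And phi (Neg psi)).
Definition Iff phi psi := And (Imp phi psi) (Imp psi phi).
End Connectives.

Fixpoint ren (S : signature) (X Y : Type) (g : X -> Y) (phi : fmla S X) :
    fmla S Y :=
  match phi with
  | Rel r l => Rel r (g \o l)
  | Eq x y => Eq (g x) (g y)
  | Bot => Bot
  | Neg p => Neg (ren g p)
  | And p q => And (ren g p) (ren g q)
  | Ex x p => Ex (g x) (ren g p)
  end.

Section Variables.
Variables (S : signature) (X : eqType).

(* all variables, free or bound *)
Fixpoint vars (phi : fmla S X) : seq X :=
  match phi with
  | Rel r l => codom l
  | Eq x y => [:: x; y]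
  | Bot => [::]
  | Neg p => vars p
  | And p q => vars p ++ vars q
  | Ex x p => x :: vars p
  end.

Definition nvars (phi : fmla S X) : nat := size (undup (vars phi)).

Fixpoint fv (phi : fmla S X) : seq X :=
  match phi with
  | Rel r l => codom l
  | Eq x y => [:: x; y]
  | Bot => [::]
  | Neg p => fv p
  | And p q => fv p ++ fv q
  | Ex x p => [seq y <- fv p | y != x]
  end.

Definition sentence (phi : fmla S X) : Prop := fv phi = [::].
End Variables.

(* t ≡_i s *)
Definition agree_off (X : eqType) (M : Type) (i : X) (t s : X -> M) : Prop :=
  forall j : X, j != i -> t j = s j.

(* Satisfaction at s with quantifiers guarded by W: the witnessing sequence
   must lie in W.  Ordinary semantics is W = setT; clique-guarded semantics is
   W = C^m(M). *)
Fixpoint sat (S : signature) (X : eqType) (M : Type) (W : set (X -> M))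
    (I : forall r : S, set ('I_(arity r) -> M)) (s : X -> M)
    (phi : fmla S X) : Prop :=
  match phi with
  | Rel r l => I r (s \o l)
  | Eq x y => s x = s y
  | Bot => False
  | Neg p => ~ sat W I s p
  | And p q => sat W I s p /\ sat W I s q
  | Ex x p => exists t : X -> M, [/\ W t, agree_off x t s & sat W I t p]
  end.

Record structure (S : signature) := Structure {
  dom :> Type;
  dom_inhabited : inhabited dom;
  interp : forall r : S, set ('I_(arity r) -> dom) }.

Definition satisfies (S : signature) (X : eqType) (M : structure S)
    (s : X -> M) (phi : fmla S X) : Prop :=
  sat [set: X -> M] (@interp S M) s phi.

Section Theories.
Variables (S : signature) (n : nat).
Implicit Types T : set (fmla S 'I_n).

(* The signature being countable, so are L_n and T. *)
Definition countable_theory T : Prop :=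
  countable [set: S] /\ (forall phi, T phi -> sentence phi).

Definition model T (M : structure S) : Prop :=
  forall phi, T phi -> forall s : 'I_n -> M, satisfies s phi.

Definition entails T (X : eqType) (phi : fmla S X) : Prop :=
  forall M : structure S, model T M -> forall s : X -> M, satisfies s phi.

Definition consistent_with T (X : eqType) (phi : fmla S X) : Prop :=
  exists M : structure S, model T M /\ exists s : X -> M, satisfies s phi.

End Theories.

HB.mixin Record isCylindric (n : nat) (d : Order.disp_t) A
    of Order.CTBDistrLattice d A := {
  cyl : 'I_n -> A -> A;
  diag : 'I_n -> 'I_n -> A;
  cyl0 : forall i, cyl i (\bot : A)%O = (\bot)%O;
  cyl_ge : forall i (x : A), (x <= cyl i x)%O;
  cylI : forall i (x y : A),
    cyl i (x `&` cyl i y)%O = (cyl i x `&` cyl i y)%O;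
  cylC : forall i j (x : A), cyl i (cyl j x) = cyl j (cyl i x);
  diagxx : forall i, diag i i = (\top : A)%O;
  diag_trans : forall i j k, k != i -> k != j ->
    diag i j = cyl k (diag i k `&` diag k j)%O;
  cyl_diag : forall i j (x : A), i != j ->
    (cyl i (diag i j `&` x) `&` cyl i (diag i j `&` ~` x))%O = (\bot)%O }.

#[short(type="cylindricType")]
HB.structure Definition Cylindric (n : nat) (d : Order.disp_t) :=
  { A of isCylindric n d A & Order.CTBDistrLattice d A }.

Section BooleanNotions.
Variables (d : Order.disp_t) (A : ctbDistrLatticeType d).

Definition atom (a : A) : Prop :=
  (\bot < a)%O /\ forall x : A, (x < a)%O -> x = (\bot)%O.

Definition coatom (a : A) : Prop :=
  (a < \top)%O /\ forall x : A, (a < x)%O -> x = (\top)%O.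

Definition atomic : Prop :=
  forall x : A, x != (\bot)%O -> exists2 a, atom a & (a <= x)%O.
End BooleanNotions.

Section Simple.
Variables (n : nat) (d : Order.disp_t) (A : cylindricType n d).

Record congruence (E : A -> A -> Prop) : Prop := {
  congr_refl : forall x, E x x;
  congr_sym : forall x y, E x y -> E y x;
  congr_trans : forall x y z, E x y -> E y z -> E x z;
  congr_meet : forall x x' y y',
    E x x' -> E y y' -> E (x `&` y)%O (x' `&` y')%O;
  congr_join : forall x x' y y',
    E x x' -> E y y' -> E (x `|` y)%O (x' `|` y')%O;
  congr_compl : forall x x', E x x' -> E (~` x)%O (~` x')%O;
  congr_cyl : forall i x x', E x x' -> E (cyl i x) (cyl i x') }.

Definition simple : Prop :=
  (\bot : A)%O <> (\top)%O /\
  forall E, congruence E ->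
    (forall x y, E x y -> x = y) \/ (forall x y, E x y).
End Simple.

HB.instance Definition _ (S : signature) (X : Type) :=
  gen_eqMixin (fmla S X).
HB.instance Definition _ (S : signature) (X : Type) :=
  gen_choiceMixin (fmla S X).

Fact lindenbaum_display : Order.disp_t. Proof. exact: Order.Disp tt tt. Qed.

Lemma agree_off_refl (X : eqType) (M : Type) (i : X) (s : X -> M) :
  agree_off i s s.
Proof. by []. Qed.

Section Lindenbaum.
Variables (S : signature) (n : nat) (T : set (fmla S 'I_n)).
Implicit Types phi psi : fmla S 'I_n.

Definition equivT phi psi : bool := `[< entails T (Iff phi psi) >].

Lemma equivTP phi psi :
  reflect (forall M, model T M -> forall s : 'I_n -> M,
    satisfies s phi = satisfies s psi) (equivT phi psi).
Proof.
apply: (iffP (asboolP _)) => H M MT s.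
  have [/= h1 h2] := H M MT s.
  rewrite propeqE; split=> h; apply: contrapT => h'; [exact: h1|exact: h2].
by rewrite /satisfies /= -!/(satisfies _ _) (H M MT s); split=> -[].
Qed.

Lemma equivT_refl : reflexive equivT.
Proof. by move=> phi; apply/equivTP. Qed.

Lemma equivT_sym : symmetric equivT.
Proof.
by move=> phi psi; apply/equivTP/equivTP => H M MT s; rewrite (H M MT).
Qed.

Lemma equivT_trans : transitive equivT.
Proof.
move=> phi psi th /equivTP H1 /equivTP H2; apply/equivTP => M MT s.
by rewrite (H1 M MT) (H2 M MT).
Qed.

Canonical equivT_equiv := EquivRel equivT equivT_refl equivT_sym equivT_trans.

Definition Fm : Type := {eq_quot equivT}.
HB.instance Definition _ := Choice.on Fm.
HB.instance Definition _ := EqQuotient.on Fm.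

(* phi/T *)
Definition cls phi : Fm := \pi_Fm phi.

Lemma cls_eq phi psi :
  cls phi = cls psi <-> entails T (Iff phi psi).
Proof.
split=> [/eqP|H]; first by rewrite /cls piE => /asboolP.
by apply/eqP; rewrite /cls piE; apply/asboolP.
Qed.

Lemma repr_cls M (MT : model T M) (s : 'I_n -> M) phi :
  satisfies s (repr (cls phi)) = satisfies s phi.
Proof.
have /eqP : cls (repr (cls phi)) = cls phi by rewrite /cls reprK.
by rewrite /cls piE => /equivTP; apply.
Qed.

Lemma Fm_ext (a b : Fm) :
  (forall M, model T M -> forall s : 'I_n -> M,
    satisfies s (repr a) = satisfies s (repr b)) -> a = b.
Proof.
by move=> H; rewrite -[a]reprK -[b]reprK; apply/eqP; rewrite piE; apply/equivTP.
Qed.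

Definition fm_bot : Fm := cls Bot.
Definition fm_top : Fm := cls (Top S 'I_n).
Definition fm_meet (a b : Fm) : Fm := cls (And (repr a) (repr b)).
Definition fm_join (a b : Fm) : Fm := cls (Or (repr a) (repr b)).
Definition fm_compl (a : Fm) : Fm := cls (Neg (repr a)).
Definition fm_cyl (i : 'I_n) (a : Fm) : Fm := cls (Ex i (repr a)).
Definition fm_diag (i j : 'I_n) : Fm := cls (Eq i j).
Definition fm_le (a b : Fm) : bool := fm_meet a b == a.
Definition fm_lt (a b : Fm) : bool := (b != a) && fm_le a b.

Section Sat.
Variables (M : structure S) (MT : model T M).
Implicit Types s : 'I_n -> M.

Lemma sat_bot s : satisfies s (repr fm_bot) = False.
Proof. by rewrite repr_cls. Qed.
Lemma sat_top s : satisfies s (repr fm_top) = True.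
Proof. by rewrite repr_cls //; rewrite propeqE; split=> // _ []. Qed.
Lemma sat_meet s a b : satisfies s (repr (fm_meet a b)) =
  (satisfies s (repr a) /\ satisfies s (repr b)).
Proof. by rewrite repr_cls. Qed.
Lemma sat_join s a b : satisfies s (repr (fm_join a b)) =
  (satisfies s (repr a) \/ satisfies s (repr b)).
Proof.
rewrite repr_cls // propeqE; split=> [H|[H|H] []] //.
by apply: contrapT => /not_orP[h1 h2]; apply: H.
Qed.
Lemma sat_compl s a : satisfies s (repr (fm_compl a)) =
  (~ satisfies s (repr a)).
Proof. by rewrite repr_cls. Qed.
Lemma sat_cyl s i a : satisfies s (repr (fm_cyl i a)) =
  (exists t : 'I_n -> M, agree_off i t s /\ satisfies t (repr a)).
Proof.
rewrite repr_cls // propeqE; split=> [[t [_ h1 h2]]|[t [h1 h2]]]; exists t => //.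
Qed.
Lemma sat_diag s i j : satisfies s (repr (fm_diag i j)) = (s i = s j).
Proof. by rewrite repr_cls. Qed.
End Sat.

Local Ltac fm_tauto :=
  let M := fresh in let MT := fresh in let s := fresh in
  intros; apply: Fm_ext => M MT s;
  rewrite ?(sat_meet MT, sat_join MT, sat_compl MT, sat_bot MT, sat_top MT)
    propeqE; tauto.

Lemma fm_meetC : commutative fm_meet. Proof. move=> a b; fm_tauto. Qed.
Lemma fm_joinC : commutative fm_join. Proof. move=> a b; fm_tauto. Qed.
Lemma fm_meetA : associative fm_meet. Proof. move=> a b c; fm_tauto. Qed.
Lemma fm_joinA : associative fm_join. Proof. move=> a b c; fm_tauto. Qed.
Lemma fm_joinKI (y x : Fm) : fm_meet x (fm_join x y) = x.
Proof. fm_tauto. Qed.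
Lemma fm_meetKU (y x : Fm) : fm_join x (fm_meet x y) = x.
Proof. fm_tauto. Qed.
Lemma fm_meetUl : left_distributive fm_meet fm_join.
Proof. move=> a b c; fm_tauto. Qed.
Lemma fm_meetxx : idempotent_op fm_meet. Proof. move=> a; fm_tauto. Qed.

HB.instance Definition _ := Order.isMeetJoinDistrLattice.Build
  lindenbaum_display Fm (fun _ _ => erefl) (fun _ _ => erefl)
  fm_meetC fm_joinC fm_meetA fm_joinA fm_joinKI fm_meetKU fm_meetUl fm_meetxx.

Lemma fm_le0x (x : Fm) : (fm_bot <= x)%O.
Proof. by apply/eqP; fm_tauto. Qed.
Lemma fm_lex1 (x : Fm) : (x <= fm_top)%O.
Proof. by apply/eqP; fm_tauto. Qed.

HB.instance Definition _ :=
  Order.hasBottom.Build lindenbaum_display Fm fm_le0x.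
HB.instance Definition _ :=
  Order.hasTop.Build lindenbaum_display Fm fm_lex1.

Lemma fm_joinxC (x : Fm) : fm_join x (fm_compl x) = fm_top.
Proof.
apply: Fm_ext => M MT s; rewrite (sat_join MT) (sat_compl MT) (sat_top MT).
by rewrite propeqE; split=> // _; exact: lem.
Qed.
Lemma fm_meetxC (x : Fm) : fm_meet x (fm_compl x) = fm_bot.
Proof. fm_tauto. Qed.

HB.instance Definition _ :=
  Order.TBDistrLattice_hasComplement.Build lindenbaum_display Fm
    fm_joinxC fm_meetxC.

Lemma fm_cyl0 i : fm_cyl i fm_bot = fm_bot.
Proof.
apply: Fm_ext => M MT s; rewrite (sat_cyl MT) (sat_bot MT) propeqE.
by split=> // -[t []]; rewrite (sat_bot MT).
Qed.

Lemma fm_cyl_ge i (x : Fm) : (x <= fm_cyl i x)%O.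
Proof.
apply/eqP; apply: Fm_ext => M MT s; rewrite (sat_meet MT) (sat_cyl MT) propeqE.
by split=> [[]//|h]; split=> //; exists s.
Qed.

Lemma agree_off_sym M (i : 'I_n) (s t : 'I_n -> M) :
  agree_off i s t -> agree_off i t s.
Proof. by move=> h j ji; rewrite h. Qed.

Lemma agree_off_trans M (i : 'I_n) (s t u : 'I_n -> M) :
  agree_off i s t -> agree_off i t u -> agree_off i s u.
Proof. by move=> h h' j ji; rewrite h // h'. Qed.

Lemma fm_cylI i (x y : Fm) :
  fm_cyl i (fm_meet x (fm_cyl i y)) = fm_meet (fm_cyl i x) (fm_cyl i y).
Proof.
apply: Fm_ext => M MT s; rewrite (sat_meet MT) !(sat_cyl MT) propeqE; split.
  move=> [t [ts]]; rewrite (sat_meet MT) (sat_cyl MT) => -[xt [u [ut yu]]].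
  by split; [exists t|exists u; split=> //; exact: agree_off_trans ut ts].
move=> [[t [ts xt]] [u [us yu]]]; exists t; split=> //.
rewrite (sat_meet MT) (sat_cyl MT); split=> //; exists u; split=> //.
by apply: (agree_off_trans us); exact: agree_off_sym.
Qed.

Lemma fm_cylC i j (x : Fm) : fm_cyl i (fm_cyl j x) = fm_cyl j (fm_cyl i x).
Proof.
have sub k l M (MT : model T M) (s : 'I_n -> M) :
    satisfies s (repr (fm_cyl k (fm_cyl l x))) ->
    satisfies s (repr (fm_cyl l (fm_cyl k x))).
  rewrite !(sat_cyl MT) => -[t [ts]]; rewrite (sat_cyl MT) => -[u [ut xu]].
  have [kl|kl] := eqVneq k l.
    by subst l; exists t; split=> //; rewrite (sat_cyl MT); exists u.
  exists (fun p => if p == l then u l else s p); split.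
    by move=> p /negPf ->.
  rewrite (sat_cyl MT); exists u; split=> // p pk.
  by case: eqVneq => [->//|pl]; rewrite ut // ts.
by apply: Fm_ext => M MT s; rewrite propeqE; split; exact: sub.
Qed.

Lemma fm_diagxx i : fm_diag i i = fm_top.
Proof.
by apply: Fm_ext => M MT s; rewrite (sat_diag MT) (sat_top MT) propeqE.
Qed.

Lemma fm_diag_trans i j k : k != i -> k != j ->
  fm_diag i j = fm_cyl k (fm_meet (fm_diag i k) (fm_diag k j)).
Proof.
move=> ki kj; apply: Fm_ext => M MT s.
rewrite (sat_diag MT) (sat_cyl MT) propeqE; split.
  move=> sij; exists (fun p => if p == k then s i else s p); split.
    by move=> p /negPf ->.
  by rewrite (sat_meet MT) !(sat_diag MT) eqxx ![_ == k]eq_sym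
       (negPf ki) (negPf kj).
move=> [t [ts]]; rewrite (sat_meet MT) !(sat_diag MT) => -[tik tkj].
by rewrite -!ts 1?eq_sym // tik.
Qed.

Lemma fm_cyl_diag i j (x : Fm) : i != j ->
  fm_meet (fm_cyl i (fm_meet (fm_diag i j) x))
          (fm_cyl i (fm_meet (fm_diag i j) (fm_compl x))) = fm_bot.
Proof.
move=> ij; apply: Fm_ext => M MT s.
rewrite (sat_meet MT) !(sat_cyl MT) (sat_bot MT) propeqE; split=> //.
move=> [[t [ts]]]; rewrite (sat_meet MT) (sat_diag MT) => -[tij xt].
move=> [u [us]]; rewrite (sat_meet MT) (sat_diag MT) (sat_compl MT) => -[uij].
suff -> : u = t by [].
have eji : j != i by rewrite eq_sym.
apply/funext => p; have [->|pi] := eqVneq p i; last by rewrite us // ts.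
by rewrite uij tij us // ts.
Qed.

HB.instance Definition _ := isCylindric.Build n lindenbaum_display Fm
  fm_cyl0 fm_cyl_ge fm_cylI fm_cylC fm_diagxx fm_diag_trans fm_cyl_diag.

Definition atomic_theory : Prop := atomic Fm.
Definition complete_theory : Prop := simple Fm.

Definition Gamma : set (fmla S 'I_n) := [set phi | coatom (cls phi)].

Definition isolates (psi : fmla S nat) : Prop :=
  consistent_with T psi /\
  forall phi, Gamma phi -> entails T (Imp psi (ren (@nat_of_ord n) phi)).

End Lindenbaum.

Inductive edim := Fin of nat | Omega.

Definition edim_ge (m : edim) (k : nat) : Prop :=
  if m is Fin m' then (k <= m')%N else True.

(* the index set {i : i < m} *)
Definition ix (m : edim) : eqType := if m is Fin k then 'I_k : eqType else nat.

Section Representations.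
Variables (n : nat) (d : Order.disp_t) (A : cylindricType n d) (M : Type).
Variables (V : set ('I_n -> M)) (f : A -> set ('I_n -> M)).

Record relativized_rep : Prop := {
  rep_base : \bigcup_(s in V) range s = [set: M];
  rep_inj : injective f;
  rep_bot : f (\bot)%O = set0;
  rep_top : f (\top)%O = V;
  rep_meet : forall a b, f (a `&` b)%O = f a `&` f b;
  rep_join : forall a b, f (a `|` b)%O = f a `|` f b;
  rep_compl : forall a, f (~` a)%O = V `\` f a;
  rep_cyl : forall i a,
    f (cyl i a) = [set s | V s /\ exists2 t, f a t & agree_off i t s];
  rep_diag : forall i j, f (diag i j) = [set s | V s /\ s i = s j] }.

Definition clique (C : set M) : Prop :=
  forall a : 'I_n -> M, (forall i, C (a i)) -> V a.

Definition cseq (m : edim) : set (ix m -> M) := [set s | clique (range s)].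

(* Changing the argument of c_i in (s_{l(0)}, ..., s_{l(n-1)}) means changing
   s at l(i), hence ≡_{l(i)}; this is ≡_i when l is the inclusion. *)
Definition square (m : edim) : Prop :=
  forall (s : ix m -> M) (a : A) (i : 'I_n) (l : 'I_n -> ix m),
    cseq s -> injective l -> f (cyl i a) (s \o l) ->
    exists t : ix m -> M, [/\ cseq t, agree_off (l i) t s & f a (t \o l)].

Definition alg_sig : signature := Signature (fun _ : A => n).

(* The language L(A)^m.  Equality is available as an atomic formula; for n >= 2
   it is in any case expressed on clique sequences by the symbol d_01. *)
Definition alg_fmla (m : edim) := fmla alg_sig (ix m).

Definition clique_sat (m : edim) (s : ix m -> M) (phi : alg_fmla m) : Prop :=
  sat (@cseq m) (f : forall r : alg_sig, set ('I_(arity r) -> M)) s phi.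

Definition flat (m : edim) : Prop :=
  square m /\
  forall (phi : alg_fmla m) (s : ix m -> M) (i j : ix m),
    cseq s -> i != j ->
    clique_sat s (Iff (Ex i (Ex j phi)) (Ex j (Ex i phi))).

End Representations.

Section Omitting.
Variables (S : signature) (n : nat) (T : set (fmla S 'I_n)).

Definition flat_model (m : edim) (M : Type) (V : set ('I_n -> M))
    (f : Fm T -> set ('I_n -> M)) : Prop :=
  relativized_rep V f /\ flat V f m.

Definition Gamma_realized (M : Type) (V : set ('I_n -> M))
    (f : Fm T -> set ('I_n -> M)) : Prop :=
  exists s, V s /\ forall phi, Gamma T phi -> f (cls T phi) s.
End Omitting.

Definition Psi_f (n l : nat) (m : edim) : Prop :=
  exists (S : signature) (T : set (fmla S 'I_n)),
    [/\ countable_theory T, atomic_theory T, complete_theory T,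
        forall (M : Type) (V : set ('I_n -> M)) (f : Fm T -> set ('I_n -> M)),
          flat_model m V f -> Gamma_realized V f
      & forall psi : fmla S nat, isolates T psi -> (l < nvars psi)%N].

(* Main.v *)
Require Import Defs.
From HB Require Import structures.
From mathcomp Require Import all_boot all_order zify.
From mathcomp Require Import boolp classical_sets functions cardinality.

(** A countable graph is built whose edges carry colours, where an edge is spanned
    by two nodes x, y together with parameters z_0, ..., z_{k-1} (n = k + 3), so that
    edges have n - 1 entries and triangles n entries.  There are two kinds of base
    nodes, b_0 and b_1, and four kinds of apexes, c_0, ..., c_3.  A base node may be
    joined to an apex or not; two apexes are linked by one of two whites, by a label
    (x, i) with x a bit and i an index, or by a limit colour that no symbol of the
    signature names.  If b_j is joined to both apexes, white j is forbidden between
    them.  In a triangle of apexes without white edge the two largest indices agree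
    (the limit colour having index infinity), and if all indices are finite then the
    bits add up to a value depending only on which three kinds of apexes occur; these
    values are chosen so that their sum over the four triangles of a tetrahedron is
    odd, which is impossible.

    An extension over n - 1 given nodes can always be linked to all other nodes by
    whites, except over z, b_0, b_1, where the limit colour is used; hence a generic
    graph exists.  A formula of L_n only sees indices below some N and cannot tell the
    limit colour from a label of larger index, and in a single triangle the former can
    be replaced by the latter.  So the L_n-theory T of the generic graph is atomic, the
    atoms being given by the tuples without limit colour.

    If a square model with n + 3 variables omits the co-atoms, all its tuples realize
    atoms.  One can place z, b_0, b_1 and then, one by one over these n - 1 points, four
    apexes joined to both base nodes.  Their links are not white and not limit, which
    contradicts the parity rule.

    Finally, a formula with at most n variables can be renamed into L_n, so that it lies
    above an atom as soon as it is consistent with T; hence it never isolates the type of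
    co-atoms of an atomic theory. *)

Set Implicit Arguments.
Unset Strict Implicit.
Unset Printing Implicit Defensive.

(** * Colours *)

(* [None] is the limit colour. *)
Definition colour : Type := option (bool + bool * nat).
Definition white (j : bool) : colour := Some (inl j).
Definition label (x : bool) (i : nat) : colour := Some (inr (x, i)).

(** The index condition is that of an ultrametric triangle: the maximum is attained twice. With
    [None] as infinity, one [None] next to two labels is refused and two are always accepted. *)
Definition label_triangle (e : bool) (al be ga : colour) : bool :=
  match al, be, ga with
  | Some (inl _), _, _ | _, Some (inl _), _ | _, _, Some (inl _) => true
  | None, None, _ | None, _, None | _, None, None => true
  | Some (inr (x, i)), Some (inr (y, j)), Some (inr (w, l)) =>
      [|| (i == j) && (l <= i), (j == l) && (i <= j) | (i == l) && (j <= i)]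
      && (x (+) y (+) w == e)
  | _, _, _ => false
  end.

(* [al], [be], [ga] are the colours of the edges xy, yw, xw of a triangle whose nodes
   x, y, w have sorts [p < q < r].  Sorts 0 and 1 are the base nodes, sorts 2 to 5 the
   apexes; between a base node and an apex, [white true] means "joined". *)
Definition triangle (p q r : nat) (al be ga : colour) : bool :=
  if p < 2 then
    (q < 2) || ~~ [&& al == white true, ga == white true & be == white (p == 1)]
  else label_triangle (r == 5) al be ga.

Definition large (N : nat) (al : colour) : bool :=
  match al with
  | None => true
  | Some (inl _) => false
  | Some (inr (_, i)) => N < i
  end.

(** Formulas mentioning no index above [N] cannot separate near colours; [None] falls together with
    the labels of index above [N]. *)
Definition near (N : nat) (al be : colour) : bool :=
  (al == be) || large N al && large N be.

Definition standardize (N : nat) (al : colour) : colour :=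
  if al is None then label false N.+1 else al.

Lemma near_refl N al : near N al al.
Proof. by rewrite /near eqxx. Qed.

Lemma near_sym N al be : near N al be = near N be al.
Proof. by rewrite /near eq_sym andbC. Qed.

Lemma near_standardize N al : near N al (standardize N al).
Proof. by case: al => [[]|] *; rewrite /near ?eqxx //=. Qed.

Lemma standardize_neq N al : standardize N al != None.
Proof. by case: al. Qed.

Lemma near_white N al be j : near N al be -> (al == white j) = (be == white j).
Proof.
case/orP=> [/eqP->//|/andP[]].
by case: al be => [[?|[? ?]]|] [[?|[? ?]]|].
Qed.

Lemma label_triangle_rot e al be ga :
  label_triangle e al be ga = label_triangle e be ga al.
Proof.
case: al be ga => [[?|[x i]]|] [[?|[y j]]|] [[?|[w l]]|] //=.
by rewrite -addbA [x (+) _]addbC; congr andb; lia.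
Qed.

Lemma label_triangle_white e al be j :
  [/\ label_triangle e (white j) al be, label_triangle e al (white j) be
    & label_triangle e al be (white j)].
Proof. by case: al be => [[?|[? ?]]|] [[?|[? ?]]|]. Qed.

Lemma label_triangle_None e al :
  [/\ label_triangle e None None al, label_triangle e None al None
    & label_triangle e al None None].
Proof. by case: al => [[?|[? ?]]|]. Qed.

(** Without white edges the largest index occurs twice, so a large [al] comes with a large [be] or
    [ga]. That edge can follow the index of [al'], and its free bit repairs the parity. *)
Lemma label_triangle_ext N e al be ga al' :
  label_triangle e al be ga -> near N al al' ->
  exists be' ga', [/\ label_triangle e al' be' ga', near N be be',
    near N ga ga' & al' != None -> be' != None /\ ga' != None].
Proof.
have [al_w|al_nw] := boolP (if al is Some (inl _) then true else false).
  case: al al_w => [[j|]|] //= _ _ nr.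
  have /eqP -> : al' == white j by rewrite -(near_white j nr) eqxx.
  exists (standardize N be), (standardize N ga).
  by rewrite !near_standardize !standardize_neq.
have [be_w|be_nw] := boolP (if be is Some (inl _) then true else false).
  case: be be_w => [[j|]|] //= _ _ nr.
  exists (white j), (standardize N ga).
  rewrite !near_standardize ?near_refl !standardize_neq; split=> //.
  by case: (al') => [[?|[? ?]]|].
have [ga_w|ga_nw] := boolP (if ga is Some (inl _) then true else false).
  case: ga ga_w => [[j|]|] //= _ _ nr.
  exists (standardize N be), (white j).
  rewrite !near_standardize ?near_refl !standardize_neq; split=> //.
  by case: (al') (standardize N be) => [[?|[? ?]]|] [[?|[? ?]]|].
move=> tri nr.
have nw' : ~~ (if al' is Some (inl _) then true else false).
  case: al' nr => [[j|]|] // nr; have := near_white j nr.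
  by rewrite eqxx => /eqP ea; rewrite ea in al_nw.
case: al' nw' nr => [[//|[x' i']]|] _ nr.
- have [i'N|i'N] := leqP i' N.
    have ? : al = label x' i'.
      case/orP: nr => [/eqP //|/andP[_] /=]; by rewrite ltnNge i'N.
    subst al.
    have [beL|beL] := boolP (large N be).
      have gaL : large N ga.
        case: be ga be_nw ga_nw tri beL => [[?|[y j]]|] [[?|[w l]]|] //=.
        by move=> _ _ /andP[h _] jN; lia.
      (* Both large edges get the least large index; the bit of the second one settles the
         parity. *)
      exists (label false N.+1), (label (x' (+) e) N.+1).
      rewrite /near beL gaL /= !ltnSn !orbT; split=> //.
      by rewrite eqxx /= (leqW i'N) orbT /= addbF addbA addbb addFb eqxx.
    have gaL : ~~ large N ga.
      case: be ga be_nw ga_nw tri beL => [[?|[y j]]|] [[?|[w l]]|] //=.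
      by move=> _ _ /andP[h _] jN; lia.
    exists be, ga; rewrite !near_refl; split=> // _.
    by split; [move: beL|move: gaL]; apply: contraNneq => ->.
  have alL : large N al by case/orP: nr => [/eqP->|/andP[]] //=.
  have [beL|beL] := boolP (large N be).
    have [gaL|gaL] := boolP (large N ga).
      exists (label false i'), (label (x' (+) e) i').
      rewrite /near beL gaL /= i'N !orbT eqxx leqnn /=; split=> //.
      by rewrite addbF addbA addbb addFb eqxx.
    case: ga ga_nw gaL tri => [[//|[w l]]|] //= _ lN tri.
    exists (label (x' (+) w (+) e) i'), (label w l).
    rewrite /near beL eqxx /= i'N !orbT; split=> //.
    apply/andP; split; first by lia.
    by case: x' w e {nr tri} => [] [] [].
  have gaL : large N ga.
    case: al be ga be_nw ga_nw tri beL alL {nr al_nw}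
       => [[?|[x i]]|] [[?|[y j]]|] [[?|[w l]]|] //=.
    by move=> _ _ /andP[h _] jN; lia.
  case: be be_nw beL tri => [[//|[w l]]|] //= _ lN tri.
  exists (label w l), (label (x' (+) w (+) e) i').
  rewrite /near gaL eqxx /= i'N !orbT; split=> //.
  apply/andP; split; first by lia.
  by case: x' w e {nr tri} => [] [] [].
- have alL : large N al by case/orP: nr => [/eqP->|/andP[]] //=.
  have [beL|beL] := boolP (large N be).
    exists None, ga; rewrite near_refl; split=> //.
      by case: ga {ga_nw tri} => [[?|[? ?]]|].
    by rewrite /near beL orbT.
  have gaL : large N ga.
    case: al be ga be_nw ga_nw tri beL alL {nr al_nw}
       => [[?|[x i]]|] [[?|[y j]]|] [[?|[w l]]|] //=.
    by move=> _ _ /andP[h _] jN; lia.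
  exists be, None; rewrite near_refl; split=> //.
    by case: be {be_nw beL tri} => [[?|[? ?]]|].
  by rewrite /near gaL orbT.
Qed.

(** * Colours of the faces of an n-tuple *)

Section ColouredTriangle.
Variable k : nat.

Definition p0 : 'I_k.+3 := @Ordinal k.+3 0 isT.
Definition p1 : 'I_k.+3 := @Ordinal k.+3 1 isT.
Definition p2 : 'I_k.+3 := @Ordinal k.+3 2 isT.
Definition q0 : 'I_k.+2 := @Ordinal k.+2 0 isT.
Definition q1 : 'I_k.+2 := @Ordinal k.+2 1 isT.

(* [c o] is the colour of the face of [G] that omits the entry [o]. *)
Definition coloured_triangle (srt : nat -> nat) (G : 'I_k.+3 -> nat)
    (c : 'I_k.+3 -> colour) : bool :=
  triangle (srt (G p0)) (srt (G p1)) (srt (G p2)) (c p2) (c p0) (c p1).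

Lemma ord3P (o : 'I_k.+3) : [\/ o = p0, o = p1, o = p2 | 3 <= o].
Proof.
case: o => [[|[|[|m]]] h].
- by constructor 1; apply: val_inj.
- by constructor 2; apply: val_inj.
- by constructor 3; apply: val_inj.
- by constructor 4.
Qed.

(** A triangle with a base node only asks which edges are white, and [near] preserves that.
    Otherwise the edge [j] is rotated to the front for [label_triangle_ext]. *)
Lemma coloured_triangle_ext N srt G (c : 'I_k.+3 -> colour) j al' :
  coloured_triangle srt G c -> near N (c j) al' ->
  exists c', [/\ c' j = al', coloured_triangle srt G c',
    forall o, near N (c o) (c' o) & al' != None -> forall o, c' o != None].
Proof.
rewrite /coloured_triangle /triangle; case: ifP => [p2|_] tri nr.
  exists (fun o => if o == j then al' else standardize N (c o)).
  have nr' o : near N (c o) (if o == j then al' else standardize N (c o)).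
    by case: eqP => [->//|_]; exact: near_standardize.
  rewrite eqxx; split=> // [|al'N o]; last by case: ifP; rewrite ?standardize_neq.
  by rewrite -!(near_white _ (nr' _)).
set e := srt (G p2) == 5 in tri *.
pose mk (x y z w : colour) (o : 'I_k.+3) :=
  match val o with 0 => x | 1 => y | 2 => z | _ => w end.
have fin x y z : 
    label_triangle e z x y -> near N (c p0) x -> near N (c p1) y ->
    near N (c p2) z -> (al' != None -> [/\ x != None, y != None & z != None]) ->
    mk x y z al' j = al' ->
  exists c', [/\ c' j = al', label_triangle e (c' p2) (c' p0) (c' p1),
    forall o, near N (c o) (c' o) & al' != None -> forall o, c' o != None].
  move=> tri' nx ny nz nN ej.
  exists (fun o => if o == j then al' else mk x y z (standardize N (c o)) o).
  have st (o : 'I_k.+3) : 3 > o ->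
     (if o == j then al' else mk x y z (standardize N (c o)) o) = mk x y z al' o.
    by case: eqP => [->|_]; rewrite ?ej //; case: o => [[|[|[|m]]] h].
  split=> [|||aN o]; first by rewrite eqxx.
  - by rewrite (st p0) // (st p1) // (st p2).
  - move=> o; case: eqP => [->//|_].
    case: (ord3P o) => [->|->|->|]; [exact: nx|exact: ny|exact: nz|].
    by case: o => [[|[|[|m]]] h] // _; exact: near_standardize.
  - case: (o =P j) => // _; have [? ? ?] := nN aN.
    by rewrite /mk; case: o => [[|[|[|m]]] h] //=; exact: standardize_neq.
case: (ord3P j) => [ej|ej|ej|j3].
- rewrite ej in nr; rewrite label_triangle_rot in tri.
  have [y [z [tri' ny nz nN]]] := label_triangle_ext tri nr.
  apply: (fin al' y z) => //; first by rewrite label_triangle_rot.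
    by move=> aN; have [] := nN aN.
  by rewrite ej.
- rewrite ej in nr; rewrite -label_triangle_rot in tri.
  have [z [x [tri' nz nx nN]]] := label_triangle_ext tri nr.
  apply: (fin x al' z) => //; first by rewrite -label_triangle_rot.
    by move=> aN; have [] := nN aN.
  by rewrite ej.
- rewrite ej in nr.
  have [x [y [tri' nx ny nN]]] := label_triangle_ext tri nr.
  apply: (fin x y al') => //.
    by move=> aN; have [] := nN aN.
  by rewrite ej.
(* The face [j] is not an edge of the triangle; standardizing one edge makes the whole triangle free
   of the limit colour. *)
- have [x [y [tri' nx ny nN]]] := label_triangle_ext tri (near_standardize N _).
  have [] := nN (standardize_neq _ _) => xN yN.
  apply: (fin x y _ tri') => //; first exact: near_standardize.
    by rewrite standardize_neq.
  by case: j j3 {nr fin} => [[|[|[|m]]] h].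
Qed.

End ColouredTriangle.

Arguments p0 {k}.
Arguments p1 {k}.
Arguments p2 {k}.
Arguments q0 {k}.
Arguments q1 {k}.

(** * The generic graph *)

Definition upd (I : eqType) (T : Type) (a : I -> T) (i : I) (u : T) (j : I) : T :=
  if j == i then u else a j.

Section GenericGraph.
Variable k : nat.
Notation n := k.+3.

(* The node [u] codes a request: a sort, a variable [i], a tuple [a] of older nodes, and
   the colours that the faces of [a] with [u] put in place [i] should receive. *)
Definition task : Type :=
  (nat * 'I_n * {ffun 'I_n -> nat} * {ffun {ffun 'I_k.+2 -> 'I_n} -> colour})%type.

Definition task_of (u : nat) : task :=
  if (unpickle u : option (nat * task)) is Some (_, t) then t
  else (0, p0, [ffun _ => 0], [ffun _ => None]).

Definition srt u : nat := (task_of u).1.1.1.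
Definition new_var u : 'I_n := (task_of u).1.1.2.
Definition base u : 'I_n -> nat := upd (task_of u).1.2 (new_var u) u.
Definition prescription u : {ffun 'I_k.+2 -> 'I_n} -> colour := (task_of u).2.

(** The codes of [t] with [b.+1] different first components cannot all lie below [b]. *)
Lemma task_of_unbounded (t : task) (b : nat) : exists2 u, b <= u & task_of u = t.
Proof.
have inj : injective (fun c : 'I_b.+1 => pickle (val c, t)).
  by move=> c c' /(pcan_inj pickleK) [] /val_inj.
have [/existsP[c bc]|/existsPn small] :=
    boolP [exists c : 'I_b.+1, b <= pickle (val c, t)].
  by exists (pickle (val c, t)); rewrite // /task_of pickleK.
have lt (c : 'I_b.+1) : pickle (val c, t) < b by rewrite ltnNge small.
have inj' : injective (fun c => Ordinal (lt c)).
  by move=> c c' /(congr1 val) /inj.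
by have := leq_card _ inj'; rewrite !card_ord ltnn.
Qed.

(* Entries 0 and 1 of a face are its two ends, the other ones its parameters; the
   parameter z_i has sort [i + 6]. *)
Definition face_sorts (F : 'I_k.+2 -> nat) : bool :=
  [&& srt (F q0) < srt (F q1), srt (F q1) < 6
    & [forall j : 'I_k.+2, (1 < j) ==> (srt (F j) == j + 4)]].

Definition tuple_sorts (G : 'I_n -> nat) : bool :=
  [&& srt (G p0) < srt (G p1), srt (G p1) < srt (G p2), srt (G p2) < 6
    & [forall j : 'I_n, (2 < j) ==> (srt (G j) == j + 3)]].

(* Avoids every white that is blocked by a base node in [base u]. *)
Definition default_label u : colour :=
  if [exists j, (j != new_var u) && (srt (base u j) == 0)] then
    if [exists j, (j != new_var u) && (srt (base u j) == 1)] then None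
    else white true
  else white false.

(** A new face leaving [base u] gets a harmless colour: [white false] (not joined) at a base node,
    [default_label u] between apexes. *)
Definition prescribed u F : colour :=
  if [pick l : {ffun 'I_k.+2 -> 'I_n} | [forall j, F j == base u (l j)]] is Some l
  then prescription u l
  else if srt (F q0) < 2 then white false else default_label u.

Definition older u (F : 'I_k.+2 -> nat) : bool := [forall j, F j < u].

(* Only faces of nodes [< u] and faces containing [u] occur here, so that the colours
   [c] of the former determine whether the request of [u] can be fulfilled. *)
Definition valid u (c : ('I_k.+2 -> nat) -> colour) : Prop :=
  (forall j, j != new_var u -> base u j < u) /\
  forall g : 'I_n -> 'I_n, tuple_sorts (base u \o g) ->
    coloured_triangle srt (base u \o g) (fun o =>
      let F := base u \o g \o lift o in
      if older u F then c F else prescribed u F).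

Definition step u c F : colour :=
  if older u F then c F
  else if face_sorts F && `[< valid u c >] then prescribed u F
  else white false.

Fixpoint partial_col m : ('I_k.+2 -> nat) -> colour :=
  if m is u.+1 then step u (partial_col u) else fun=> white false.

Definition col F := partial_col (\max_j F j).+1 F.

Lemma partial_col_stable m F : older m F -> partial_col m F = col F.
Proof.
rewrite /col => /forallP Fm.
have : \max_j F j < m by rewrite (@bigmax_eq_arg _ q0).
elim: m {Fm} => // m IH; rewrite ltnS leq_eqVlt => /orP[/eqP->//|lt].
rewrite -IH // /= /step ifT //; apply/forallP => j.
exact: leq_ltn_trans (leq_bigmax _) lt.
Qed.

Lemma step_ext u c c' F : (forall F', older u F' -> c F' = c' F') ->
  step u c F = step u c' F.
Proof.
move=> cc'; rewrite /step; case: ifP => [/cc'//|_].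
suff -> : valid u c = valid u c' by [].
congr (_ /\ _); apply: eq_forall => g; apply: eq_forall => _; congr is_true.
by rewrite /coloured_triangle /=; congr triangle; case: ifP => // /cc'.
Qed.

(** The colouring satisfies its own recursion: validity at [u] consults older faces only, and on
    these the stage [u] agrees with [col]. *)
Lemma col_step u F : (forall j, F j <= u) -> col F = step u col F.
Proof.
move=> Fu; rewrite -(@partial_col_stable u.+1); last by apply/forallP.
by apply: step_ext => F'; exact: partial_col_stable.
Qed.

Lemma col_improper F : ~~ face_sorts F -> col F = white false.
Proof.
move=> Fs; rewrite /col; elim: (_.+1) => //= m IH.
by rewrite /step (negPf Fs) IH /=; case: ifP.
Qed.

Lemma tuple_sorts_face G (o : 'I_n) :
  tuple_sorts G -> o < 3 -> face_sorts (G \o lift o).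
Proof.
move=> /and4P[s01 s12 s26 /forallP sz] o3.
have lq (q : 'I_k.+2) (p : 'I_n) : bump o q = p -> (G \o lift o) q = G p.
  by move=> e /=; congr G; apply: val_inj.
have [e0 e1] : (G \o lift o) q0 = (if val o == 0 then G p1 else G p0) /\
    (G \o lift o) q1 = (if val o < 2 then G p2 else G p1).
  by case: o o3 lq => [[|[|[|o]]] h] //= _ lq; split; exact: lq.
rewrite /face_sorts e0 e1; apply/and3P; split.
- by case: ifP; case: ifP => //; [|move=> _ _; exact: ltn_trans s12]; lia.
- by case: ifP => // _; exact: ltn_trans s26.
apply/forallP => j; apply/implyP => j1.
have ej : lift o j = j.+1 :> nat by rewrite /= /bump; lia.
have := sz (lift o j); rewrite ej ltnS j1 /= => /eqP ->; apply/eqP; lia.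
Qed.

Lemma tuple_sorts_mono G (i j : 'I_n) :
  tuple_sorts G -> i < j -> srt (G i) < srt (G j).
Proof.
move=> /and4P[s01 s12 s26 /forallP sz] ij; have [j2|j2] := ltnP 2 j; last first.
  case: (ord3P i) ij => [->|->|->|i2]; case: (ord3P j) => [->|->|->|j3] //;
    rewrite /=; lia.
have /eqP -> : srt (G j) == j + 3 by have := sz j; rewrite j2.
have [i2|i2] := ltnP 2 i.
  by have := sz i; rewrite i2 /= => /eqP ->; lia.
suff : srt (G i) < 6 by lia.
by case: (ord3P i) => [->|->|->|]; lia.
Qed.

Lemma tuple_sorts_inj G : tuple_sorts G -> injective (srt \o G).
Proof.
move=> Gs i j /= e; apply: val_inj.
by case: (ltngtP i j) => // ij; have := tuple_sorts_mono Gs ij; rewrite e ltnn.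
Qed.

Lemma face_sorts_inj F : face_sorts F -> injective (srt \o F).
Proof.
move=> /and3P[s01 s16 /forallP sz].
have up (i j : 'I_k.+2) : i < j -> srt (F i) < srt (F j).
  have q01 (i' : 'I_k.+2) : i' <= 1 -> i' = q0 \/ i' = q1.
    by case: i' => [[|[|m]] h] // _; [left|right]; apply: val_inj.
  move=> ij; have [j1|j1] := ltnP 1 j; last first.
    have i1 : i <= 1 by lia.
    by case: (q01 j j1) ij => ->; case: (q01 i i1) => -> //=; lia.
  have /eqP -> : srt (F j) == j + 4 by have := sz j; rewrite j1.
  have [i2|i2] := ltnP 1 i.
    by have := sz i; rewrite i2 /= => /eqP ->; lia.
  by case: (q01 i i2) => ->; lia.
move=> i j /= e; apply: val_inj; case: (ltngtP i j) => // /up; rewrite e ltnn //.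
Qed.

Lemma prescribed_notin u F x :
  (forall j, F x != base u j) ->
  prescribed u F = if srt (F q0) < 2 then white false else default_label u.
Proof.
move=> Fx; rewrite /prescribed; case: pickP => // l /forallP/(_ x)/eqP e.
by have := Fx (l x); rewrite e eqxx.
Qed.

Lemma base_new_var u : base u (new_var u) = u.
Proof. by rewrite /base /upd eqxx. Qed.

(* [base u] has only [k.+3] entries, so it cannot contain the [k.+2] nodes of a
   label face in addition to nodes of both sorts 0 and 1. *)
Lemma prescribed_default_None u F :
  face_sorts F -> 1 < srt (F q0) -> default_label u = None ->
  prescribed u F = None.
Proof.
move=> Fs F0 dN; rewrite /prescribed; case: pickP => [l /forallP Fl|_]; last first.
  by rewrite ltnNge F0.
move: dN; rewrite /default_label.
case: ifP => // /existsP[j0 /andP[_ /eqP b0]].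
case: ifP => // /existsP[j1 /andP[_ /eqP b1]] _.
have Fbig x : 1 < srt (F x).
  case/and3P: Fs => s01 _ /forallP sz; have [x1|x1] := ltnP 1 x.
    by have := sz x; rewrite x1 => /eqP ->; lia.
  have [->//|->] : x = q0 \/ x = q1.
    by case: x x1 => [[|[|m]] h] // _; [left|right]; apply: val_inj.
  exact: ltn_trans s01.
have : size ([:: 0; 1] ++ [seq srt (F x) | x <- enum 'I_k.+2]) <=
       size [seq srt (base u j) | j <- enum 'I_n].
  apply: uniq_leq_size.
    have notin y : y < 2 -> y \notin [seq srt (F x) | x <- enum 'I_k.+2].
      by move=> y2; apply/negP => /mapP[x _ ey]; have := Fbig x; rewrite -ey; lia.
    rewrite !cons_uniq inE negb_or !notin //=.
    by rewrite (map_inj_uniq (face_sorts_inj Fs)) enum_uniq.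
  move=> y; rewrite !inE => /or3P[/eqP->|/eqP->|/mapP[x _ ->]]; apply/mapP.
  - by exists j0; rewrite ?mem_enum.
  - by exists j1; rewrite ?mem_enum.
  - by exists (l x); rewrite ?mem_enum // (eqP (Fl x)).
by rewrite size_cat 2!size_map !size_enum_ord ltnn.
Qed.

(** Let [u] be the newest node of [G], at place [jm]. Only the face omitting [jm] is older than [u];
    the others follow the request of [u] or its defaults, according to whether [G] lies inside
    [base u]. *)
Lemma col_triangle G : tuple_sorts G ->
  coloured_triangle srt G (fun o => col (G \o lift o)).
Proof.
move=> Gs; have Gi := tuple_sorts_inj Gs.
have [jm _ Gjm] : exists2 jm, true & forall j, G j <= G jm.
  exists [arg max_(j > p0 | true) G j] => // j.
  by case: arg_maxnP => // jm _; apply.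
set u := G jm in Gjm.
have olderE (o : 'I_n) : older u (G \o lift o) = (o == jm).
  apply/forallP/eqP => [lt|-> x /=].
    apply/eqP; apply: contraT => ojm.
    have [x ex _] := unlift_some ojm.
    by have := lt x; rewrite /= -ex ltnn.
  rewrite ltn_neqAle Gjm andbT; apply/eqP => e.
  by have /eqP := neq_lift jm x; apply; apply: Gi; rewrite /= e.
have colE (o : 'I_n) : o < 3 -> col (G \o lift o) =
    if o == jm then col (G \o lift o)
    else if `[< valid u col >] then prescribed u (G \o lift o) else white false.
  move=> o3; rewrite {1}(@col_step u); last by move=> x; exact: Gjm.
  by rewrite /step olderE (tuple_sorts_face Gs).
case: (asboolP (valid u col)) colE => [[_ vu]|_] colE; last first.
  (* The request is ignored, so at least two of the three edges are [white false]. *)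
  have wf (o : 'I_n) : o < 3 -> o != jm -> col (G \o lift o) = white false.
    by move=> o3 ojm; rewrite colE // (negPf ojm).
  rewrite /coloured_triangle /triangle; case: ifP => [_|_].
    have [e|ne] := eqVneq p2 jm; last by rewrite (wf p2) // orbT.
    by rewrite (wf p1) ?andbF ?orbT // -e.
  have [w _ _] := label_triangle_white (srt (G p2) == 5)
    (col (G \o lift p0)) (col (G \o lift p1)) false.
  have [e|ne] := eqVneq p2 jm; last by rewrite (wf p2).
  have [_ _ w'] := label_triangle_white (srt (G p2) == 5)
    (col (G \o lift p2)) (col (G \o lift p0)) false.
  by rewrite (wf p1) -?e.
have [[g Gg]|ncont] := pselect (exists g : 'I_n -> 'I_n, G = base u \o g).
  have := vu g; rewrite -Gg => /(_ Gs); rewrite /coloured_triangle /=.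
  rewrite !olderE (colE p0) // (colE p1) // (colE p2) //.
  by case: (p0 == jm); case: (p1 == jm); case: (p2 == jm).
(* Some entry [x] is now outside [base u], and a face through both [u] and [x] has the default
   colour. *)
have [x xnb] : exists x, forall j, G x != base u j.
  apply: contrapT => H; apply: ncont.
  have H' x : exists j, G x == base u j.
    by apply: contrapT => /forallNP h; apply: H; exists x => j; exact/negP.
  exists (fun x => xchoose (H' x)); apply/funext => x.
  exact/eqP/(xchooseP (H' x)).
have xjm : x != jm.
  by apply: contraNneq (xnb (new_var u)) => ->; rewrite base_new_var.
have dfl (o : 'I_n) : o < 3 -> o != jm -> o != x -> col (G \o lift o) =
    if srt (G (lift o q0)) < 2 then white false else default_label u.
  move=> o3 ojm ox; rewrite colE // (negPf ojm).
  have [y ey _] := unlift_some ox.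
  by apply: (@prescribed_notin _ _ y) => j; rewrite /= -ey.
have [l00 l10 l20] : [/\ lift p0 q0 = p1 :> 'I_n, lift p1 q0 = p0 :> 'I_n
    & lift p2 q0 = p0 :> 'I_n] by split; apply: val_inj.
rewrite /coloured_triangle /triangle; case: ifP => [plow|phigh].
  have [//|qhigh] := ltnP (srt (G p1)) 2.
  (* In a forbidden triangle the base node is joined to both apexes, which must then be [u] and the
     entry [x]. The base node lies in [base u], so the default label between the apexes avoids the
     white that it blocks. *)
  apply/negP => /and3P[/eqP c2 /eqP c1 /eqP c0].
  have e1 : (p1 == jm) || (p1 == x).
    apply: contraT; rewrite negb_or => /andP[h h'].
    by move: c1; rewrite dfl // l10 plow.
  have e2 : (p2 == jm) || (p2 == x).
    apply: contraT; rewrite negb_or => /andP[h h'].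
    by move: c2; rewrite dfl // l20 plow.
  have [n0 n0' cx x3 lx] : [/\ p0 != jm, p0 != x, col (G \o lift x) = white true,
      x < 3 & lift x q0 = p0].
    case/orP: e1 => /eqP e1; case/orP: e2 => /eqP e2; try by move: e2; rewrite -e1.
      by rewrite -e1 -e2.
    by rewrite -e1 -e2.
  have [j ej] : exists j, G p0 = base u j.
    move: cx; rewrite colE // (negPf xjm) /prescribed.
    case: pickP => [l /forallP/(_ q0)/eqP /= e _|_]; last by rewrite /= lx plow.
    by exists (l q0); rewrite -e lx.
  have jnew : j != new_var u.
    apply: contraNneq n0 => ej'; apply/eqP/Gi; rewrite /= ej ej' base_new_var //.
  move: c0; rewrite dfl // l00 ltnNge qhigh /= /default_label.
  case es: (srt (G p0)) plow => [|[|//]] _; rewrite ej in es.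
    have -> : [exists j, (j != new_var u) && (srt (base u j) == 0)].
      by apply/existsP; exists j; rewrite jnew es.
    by case: ifP.
  have -> : [exists j, (j != new_var u) && (srt (base u j) == 1)].
    by apply/existsP; exists j; rewrite jnew es.
  by case: ifP.
have phi (o : 'I_n) : o < 3 -> 1 < srt (G (lift o q0)).
  have p0hi : 1 < srt (G p0) by rewrite ltnNge -ltnS phigh.
  case/and4P: Gs => s01 _ _ _.
  have p1hi := ltn_trans p0hi s01.
  by case: (ord3P o) => [->|->|->|]; rewrite ?l00 ?l10 ?l20 //; lia.
have [dN|[b db]] : default_label u = None \/ exists b, default_label u = white b.
- rewrite /default_label; case: ifP => _; last by right; exists false.
  by case: ifP => _; [left|right; exists true].
(* Every new edge has the limit colour, and at most one of the three edges is old. *)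
- have cN (o : 'I_n) : o < 3 -> o != jm -> col (G \o lift o) = None.
    move=> o3 ojm; rewrite colE // (negPf ojm).
    by apply: prescribed_default_None; rewrite ?(tuple_sorts_face Gs) //= phi.
  have [e|ne] := eqVneq p0 jm.
    rewrite (cN p1) -?e // (cN p2) -?e //.
    by have [] := label_triangle_None (srt (G p2) == 5) (col (G \o lift p0)).
  have [e|ne'] := eqVneq p1 jm.
    rewrite (cN p0) -?e // (cN p2) -?e //.
    by have [] := label_triangle_None (srt (G p2) == 5) (col (G \o lift p1)).
  rewrite (cN p0) // (cN p1) //.
  by have [] := label_triangle_None (srt (G p2) == 5) (col (G \o lift p2)).
(* One of the three omitted places differs from [jm] and [x], so the edge opposite to it is
   white. *)
- have cw (o : 'I_n) : o < 3 -> o != jm -> o != x -> col (G \o lift o) = white b.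
    by move=> o3 ojm ox; rewrite dfl // ltnNge phi.
  have [e|ne] := boolP ((p0 != jm) && (p0 != x)).
    case/andP: e => e e'; rewrite (cw p0) //.
    by have [] := label_triangle_white (srt (G p2) == 5) (col (G \o lift p2))
      (col (G \o lift p1)) b.
  have [e1|ne1] := boolP ((p1 != jm) && (p1 != x)).
    case/andP: e1 => e e'; rewrite (cw p1) //.
    by have [] := label_triangle_white (srt (G p2) == 5) (col (G \o lift p2))
      (col (G \o lift p0)) b.
  rewrite (cw p2) //.
  - by apply/eqP => e; move: ne ne1; rewrite -e => /negPn/eqP <- /negP[].
  - by apply/eqP => e; move: ne ne1; rewrite -e !andbT => /negPn/eqP <- /negP[].
Qed.

End GenericGraph.

(** * Back and forth *)

Section Homogeneity.
Variable k : nat.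
Notation n := k.+3.
Notation srt := (@srt k).
Notation col := (@col k).

(** The node is a code of the request, chosen above all entries of [a]; the second hypothesis makes
    the request valid. The first one is there because [prescribed] may pick another [l] describing
    the same face. *)
Lemma extension (a : 'I_n -> nat) (i : 'I_n) (sigma : nat)
    (pr : ('I_k.+2 -> 'I_n) -> colour) :
  (forall l l', (forall x, (l x == i) = (l' x == i)) ->
     (forall x, l x != i -> a (l x) = a (l' x)) -> pr l = pr l') ->
  (forall u g, srt u = sigma -> (forall j, j != i -> a j < u) ->
     tuple_sorts (upd a i u \o g) ->
     coloured_triangle srt (upd a i u \o g) (fun o =>
       if i \in codom (g \o lift o) then pr (g \o lift o)
       else col (a \o g \o lift o))) ->
  exists u, [/\ srt u = sigma, forall j, j != i -> a j < u
    & forall l, i \in codom l -> face_sorts (upd a i u \o l) ->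
        col (upd a i u \o l) = pr l].
Proof.
move=> pr_ext tri.
pose t : task k := (sigma, i, finfun a, [ffun l : {ffun _} => pr l]).
have [u bu ut] := task_of_unbounded t (\max_j a j).+1.
have lt_u j : a j < u by apply: leq_trans bu; rewrite ltnS leq_bigmax.
have base_u : @base k u = upd a i u.
  rewrite /base /new_var ut /=; apply/funext => j.
  by rewrite /upd; case: eqP => // _; rewrite ffunE.
have new_u : @new_var k u = i by rewrite /new_var ut.
have updE l x : l x != i -> upd a i u (l x) = a (l x).
  by move=> /negPf li; rewrite /upd li.
have updi l x : (upd a i u (l x) == u) = (l x == i).
  by rewrite /upd; case: (l x =P i) => _; rewrite ?eqxx // ltn_eqF.
have older_u (l : 'I_k.+2 -> 'I_n) :
    older u (upd a i u \o l) = (i \notin codom l).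
  apply/forallP/negP => [lt /codomP[x ix]|il x /=].
    by have := lt x; rewrite /= -ix /upd eqxx ltnn.
  rewrite updE //; apply: contra_notN il => /eqP <-; exact: codom_f.
have prescribed_u (l : 'I_k.+2 -> 'I_n) :
    prescribed u (upd a i u \o l) = pr l.
  rewrite /prescribed base_u; case: pickP => [l' /forallP ll'|/(_ (finfun l))].
    rewrite /prescription ut /= ffunE; apply: pr_ext => x.
      by have /eqP /= e := ll' x; rewrite -!updi -e.
    move=> l'x; have /eqP /= e := ll' x.
    rewrite -(updE _ _ _ l'x) -e updE //.
    by apply: contraNN l'x; rewrite -!updi e.
  by move/negP; case; apply/forallP => x; rewrite ffunE.
have vu : @valid k u col.
  split=> [j|g gs]; first by rewrite new_u base_u => ji; rewrite (updE _ id).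
  move: gs; rewrite base_u => gs.
  have := tri u g _ (fun j _ => lt_u j) gs; rewrite {1}/srt ut => /(_ erefl).
  congr is_true; congr coloured_triangle; apply/funext => o /=.
  rewrite -[(upd _ _ _ \o g) \o _]/(upd a i u \o (g \o lift o)) older_u prescribed_u.
  rewrite if_neg; case: ifPn => // il; congr col; apply/funext => x /=.
  by rewrite updE //; apply: contraNneq il => <-; exact: codom_f.
exists u; split=> // [|l il ls]; first by rewrite /srt ut.
rewrite (@col_step _ u); last first.
  by move=> x /=; rewrite /upd; case: eqP => // _; exact: ltnW.
by rewrite /step older_u il ls /=; case: asboolP.
Qed.

(** Sorts increase strictly along a proper tuple, so both maps are the bijection that lists the
    entries of [S] by sort. *)
Lemma tuple_sorts_uniq (S : 'I_n -> nat) (g g' : 'I_n -> 'I_n) :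
  tuple_sorts (S \o g) -> tuple_sorts (S \o g') -> g = g'.
Proof.
move=> gs gs'.
have g_inj : injective g by move=> x y e; apply: (tuple_sorts_inj gs); rewrite /= e.
have g_inj' : injective g'.
  by move=> x y e; apply: (tuple_sorts_inj gs'); rewrite /= e.
have S_inj : injective (srt \o S).
  move=> x y; rewrite -(f_invF g_inj x) -(f_invF g_inj y) => e.
  by congr g; apply: (tuple_sorts_inj gs).
have srted h : tuple_sorts (S \o h) ->
    sorted ltn [seq srt (S (h x)) | x <- enum 'I_n].
  move=> hs; apply: (homo_sorted (e := relpre val ltn)) => [x y|].
    exact: (tuple_sorts_mono hs).
  by rewrite -sorted_map val_enum_ord iota_ltn_sorted.
have eqs : [seq srt (S (g x)) | x <- enum 'I_n] =
           [seq srt (S (g' x)) | x <- enum 'I_n].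
  apply: (irr_sorted_eq ltn_trans ltnn); [exact: srted|exact: srted|move=> y].
  apply/mapP/mapP => -[x _ ->].
    by exists (invF g_inj' (g x)); rewrite ?mem_enum ?f_invF.
  by exists (invF g_inj (g' x)); rewrite ?mem_enum ?f_invF.
apply/funext => x; apply: S_inj => /=.
by move/eq_in_map: eqs => -> //; rewrite mem_enum.
Qed.

(* The relation preserved by all formulas of L_n that mention no index above [N]. *)
Definition similar N (s s' : 'I_n -> nat) : Prop :=
  [/\ forall i j, (s i == s j) = (s' i == s' j),
      forall i, srt (s i) = srt (s' i)
    & forall l : 'I_k.+2 -> 'I_n, near N (col (s \o l)) (col (s' \o l))].

(** All colours of a standard tuple are named by symbols, so a single formula can describe it; these
    tuples yield the atoms. *)
Definition standard (s : 'I_n -> nat) : Prop :=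
  forall l : 'I_k.+2 -> 'I_n, col (s \o l) != None.

Lemma updE (T : Type) (a : 'I_n -> T) i u (X : Type) (l : X -> 'I_n) x :
  l x != i -> upd a i u (l x) = a (l x).
Proof. by move=> /negPf li; rewrite /upd li. Qed.

Lemma upd_notin (T : Type) (a : 'I_n -> T) i u (X : finType) (l : X -> 'I_n) :
  i \notin codom l -> upd a i u \o l = a \o l.
Proof.
move=> il; apply/funext => x /=; rewrite updE //.
by apply: contraNneq il => <-; exact: codom_f.
Qed.

(** A repeated node is copied. For a new one, at most one rearrangement of the entries is properly
    sorted, so a single triangle must be respected, and [coloured_triangle_ext] adapts it. *)
Lemma back_and_forth N (s s' : 'I_n -> nat) i u : similar N s s' ->
  exists u', similar N (upd s i u) (upd s' i u') /\
    (standard s' -> standard (upd s' i u')).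
Proof.
move=> [s_eq s_srt s_col].
have [[j ji ju]|new] := pselect (exists2 j, j != i & s j = u).
  pose h x := if x == i then j else x.
  have hE (t : 'I_n -> nat) : upd t i (t j) = t \o h.
    by apply/funext => x; rewrite /upd /= /h; case: eqP.
  exists (s' j); rewrite -ju !hE; split; last by move=> st l; exact: (st (h \o l)).
  by split=> *; [exact: s_eq|exact: s_srt|exact: s_col].
set S := upd s i u.
have new' j : j != i -> (s j == u) = false.
  by move=> ji; apply/eqP => ju; apply: new; exists j.
suff [pr [pr_near pr_ext pr_std pr_tri]] : exists pr : ('I_k.+2 -> 'I_n) -> colour,
  [/\ forall l, near N (col (S \o l)) (pr l),
      forall l l', S \o l = S \o l' -> pr l = pr l',
      standard s' -> forall l, pr l != None
    & forall u' g, srt u' = srt u -> (forall j, j != i -> s' j < u') ->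
       tuple_sorts (upd s' i u' \o g) ->
       coloured_triangle srt (upd s' i u' \o g) (fun o =>
         if i \in codom (g \o lift o) then pr (g \o lift o)
         else col (s' \o g \o lift o))].
  have [|u' [u's u'_lt u'_col]] := @extension s' i (srt u) pr _ pr_tri.
    move=> l l' eqi eqs; apply: pr_ext; apply/funext => x /=.
    rewrite /S /upd -eqi; case: eqP => // /eqP lx; apply/eqP.
    by rewrite s_eq; apply/eqP/eqs.
  have S_srt x : srt (S x) = srt (upd s' i u' x).
    by rewrite /S /upd; case: eqP; rewrite // s_srt.
  have colE l : col (upd s' i u' \o l) =
      if i \in codom l then if face_sorts (S \o l) then pr l else white false
      else col (s' \o l).
    have -> : face_sorts (S \o l) = face_sorts (upd s' i u' \o l).
      rewrite /face_sorts /= !S_srt; congr [&& _, _ & _].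
      by apply: eq_forallb => j; rewrite S_srt.
    case: ifPn => [il|il]; last by rewrite upd_notin.
    by case: ifPn => [fs|/col_improper //]; exact: u'_col.
  exists u'; split; last first.
    move=> st l; rewrite colE; case: ifP => // _; case: ifP => // _.
    exact: pr_std.
  split=> // [x y|l].
    rewrite /S /upd; case: (x =P i) => [_|/eqP xi]; case: (y =P i) => [_|/eqP yi].
    - by rewrite !eqxx.
    - by rewrite eq_sym new' // gtn_eqF // u'_lt.
    - by rewrite new' // ltn_eqF // u'_lt.
    - exact: s_eq.
  rewrite colE; case: ifPn => [il|il]; last by rewrite /S upd_notin.
  by case: ifPn => [_|/col_improper ->]; [exact: pr_near|exact: near_refl].
have sorts_S u' (g : 'I_n -> 'I_n) : srt u' = srt u ->
    tuple_sorts (upd s' i u' \o g) -> tuple_sorts (S \o g).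
  move=> u's; have e x : srt ((upd s' i u' \o g) x) = srt ((S \o g) x).
    by rewrite /S /= /upd; case: eqP; rewrite // s_srt.
  rewrite /tuple_sorts !e => /and4P[-> -> -> /forallP h].
  by apply/forallP => x; have := h x; rewrite e.
have [[g gs]|nog] :=
  pselect (exists g : 'I_n -> 'I_n, tuple_sorts (S \o g)); last first.
  exists (fun l => standardize N (col (S \o l))); split=> [l|l l' ->||u' g u's _] //.
  - exact: near_standardize.
  - by move=> _ l; exact: standardize_neq.
  - by move=> /sorts_S gs; case: nog; exists g; exact: gs.
have g_inj : injective g by move=> x y e; apply: (tuple_sorts_inj gs); rewrite /= e.
have S_inj : injective S.
  move=> x y; rewrite -(f_invF g_inj x) -(f_invF g_inj y) => e.
  by congr g; apply: (tuple_sorts_inj gs); rewrite /= e.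
pose j := invF g_inj i.
have gj : g j = i by rewrite /j f_invF.
have j_codom o : (i \in codom (g \o lift o)) = (o != j).
  apply/codomP/idP => [[x /= e]|oj].
    apply: contra_eqN e => /eqP ->; rewrite -{1}gj eq_sym (inj_eq g_inj) eq_sym.
    exact: neq_lift.
  by have [x e _] := unlift_some oj; exists x; rewrite /= -e gj.
(* Among the faces of the sorted tuple, only the one avoiding [i] is already coloured in [s']. *)
have nr : near N (col (S \o g \o lift j)) (col (s' \o g \o lift j)).
  have -> : S \o g \o lift j = s \o (g \o lift j).
    by rewrite -(@upd_notin _ s i u) // j_codom eqxx.
  exact: s_col.
have [c' [c'j c'_tri c'_near c'_std]] :=
  coloured_triangle_ext (col_triangle gs) nr.
(* Faces of the sorted tuple follow the adapted triangle; the other ones are standardized. *)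
pose pr (l : 'I_k.+2 -> 'I_n) :=
  if [pick o : 'I_n | [forall x : 'I_k.+2, l x == g (lift o x)]] is Some o then c' o
  else standardize N (col (S \o l)).
have prE o : pr (g \o lift o) = c' o.
  rewrite /pr; case: pickP => [o' /forallP h|/(_ o)/negP[]]; last exact/forallP.
  have [->//|oo'] := eqVneq o o'.
  have := oo'; rewrite eq_sym => /unlift_some [x e _].
  have /eqP/g_inj/eqP := h x; rewrite -e eq_sym => e'.
  by have := neq_lift o x; rewrite e'.
exists pr; split=> [l|l l' ll'|st l|u' g' u's _ /(sorts_S _ _ u's)/(tuple_sorts_uniq gs) <-].
- rewrite /pr; case: pickP => [o /forallP h|_]; last exact: near_standardize.
  suff -> : S \o l = S \o g \o lift o by exact: c'_near.
  by apply/funext => x /=; rewrite (eqP (h x)).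
- by congr pr; apply/funext => x; apply: S_inj; exact: (congr1 (@^~ x) ll').
- rewrite /pr; case: pickP => [o _|_]; last exact: standardize_neq.
  exact/c'_std/st.
- have -> : (fun o => if i \in codom (g \o lift o) then pr (g \o lift o)
      else col (s' \o g \o lift o)) = c'.
    by apply/funext => o; rewrite j_codom prE; case: eqP => [->|].
  have e x : srt ((upd s' i u' \o g) x) = srt ((S \o g) x).
    by rewrite /S /= /upd; case: eqP; rewrite // s_srt.
  by move: c'_tri; rewrite /coloured_triangle !e.
Qed.

End Homogeneity.

Import Order.Theory.
Local Open Scope classical_set_scope.
Local Open Scope quotient_scope.

(** * Formulas with at most n variables *)

Section Renaming.
Variables (S : signature) (M : Type) (I : forall r : S, set ('I_(arity r) -> M)).

Lemma sat_fv (X : eqType) (phi : fmla S X) (s s' : X -> M) :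
  (forall x, x \in fv phi -> s x = s' x) ->
  sat setT I s phi -> sat setT I s' phi.
Proof.
elim: phi s s' => [r l|x y||p IH|p IHp q IHq|x p IH] s s' /= ss'.
- suff -> : s \o l = s' \o l by [].
  by apply/funext => j /=; apply/ss'/codom_f.
- by rewrite !ss' // !inE eqxx ?orbT.
- by [].
- by apply: contra_not; apply: IH => x /ss'.
- case=> /IHp sp /IHq sq; split; [apply: sp|apply: sq] => x xf;
    by apply: ss'; rewrite mem_cat xf ?orbT.
- case=> t [_ ts /IH tp]; exists (fun y => if y == x then t x else s' y).
  split=> // [y /negPf -> //|]; apply: tp => y yp.
  by case: eqP => [-> //|/eqP yx]; rewrite ts // ss' // mem_filter yx.
Qed.

Lemma sat_ren (X Y : eqType) (g : X -> Y) (phi : fmla S X) :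
  {in vars phi &, injective g} -> forall (s : X -> M) (s' : Y -> M),
  (forall x, x \in vars phi -> s x = s' (g x)) ->
  sat setT I s phi <-> sat setT I s' (ren g phi).
Proof.
elim: phi => [r l|x y||p IH|p IHp q IHq|x p IH] /= g_inj s s' ss'.
- suff -> : s \o l = s' \o (g \o l) by [].
  by apply/funext => j /=; apply/ss'/codom_f.
- by rewrite !ss' // !inE eqxx ?orbT.
- by [].
- by rewrite (IH g_inj s s' ss').
- have sub1 x : x \in vars p -> x \in vars p ++ vars q.
    by rewrite mem_cat => ->.
  have sub2 x : x \in vars q -> x \in vars p ++ vars q.
    by rewrite mem_cat orbC => ->.
  rewrite (IHp _ s s'); last by move=> x /sub1/ss'.
    rewrite (IHq _ s s') //; last by move=> x /sub2/ss'.
    by move=> x y /sub2 xp /sub2; exact: g_inj.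
  by move=> x y /sub1 xp /sub1; exact: g_inj.
- have sub y : y \in vars p -> y \in x :: vars p by rewrite inE orbC => ->.
  have gx y : y \in vars p -> y != x -> g y != g x.
    move=> yp; apply: contraNneq => e; apply/eqP/g_inj => //.
      exact: sub.
    by rewrite inE eqxx.
  have g_inj' : {in vars p &, injective g}.
    by move=> y z /sub yp /sub; exact: g_inj.
  split=> -[t [_ ts tp]].
    exists (fun y => if y == g x then t x else s' y).
    split=> // [y /negPf -> //|].
    apply: (proj1 (IH g_inj' t _ _) tp) => y yp; have [->|yx] := eqVneq y x.
      by rewrite eqxx.
    by rewrite (negPf (gx y yp yx)) ts // ss' // sub.
  exists (fun y => if y == x then t (g x) else s y).
  split=> // [y /negPf -> //|].
  apply: (proj2 (IH g_inj' _ t _) tp) => y yp; have [->//|yx] := eqVneq y x.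
  by rewrite ss' ?sub // ts // gx.
Qed.

End Renaming.

Lemma atom_coatom_compl d (A : ctbDistrLatticeType d) (a : A) :
  atom a -> coatom (~` a)%O.
Proof.
case=> a0 amin; split=> [|x ax].
  by rewrite lt_neqAle lex1 andbT -compl0 (inj_eq (can_inj complK)) gt_eqF.
rewrite -[x]complK (amin (~` x)%O) ?compl0 //.
move: ax; rewrite !lt_neqAle leCx => /andP[ax ->]; rewrite andbT.
by apply: contraNneq ax => <-; rewrite complK.
Qed.

(** Variables up to [N] stay, and the others in [X] move to values up to [N] missing from [X];
    counting shows that there are enough. Fixing every [j] keeps the formulas of [Gamma]
    unchanged. *)
Lemma fold_variables (N : nat) (X : seq nat) : uniq X -> size X <= N.+1 ->
  exists g : nat -> 'I_N.+1,
    {in X &, injective g} /\ forall j : 'I_N.+1, g j = j.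
Proof.
move=> X_uniq X_size.
pose hi := [seq x <- X | N < x]; pose free := [seq y <- iota 0 N.+1 | y \notin X].
have free_uniq : uniq free by rewrite filter_uniq // iota_uniq.
have hi_free : size hi <= size free.
  have eq_lo : size [seq x <- X | x <= N] = size [seq y <- iota 0 N.+1 | y \in X].
    apply/perm_size/uniq_perm; rewrite ?filter_uniq ?iota_uniq // => y.
    by rewrite !mem_filter mem_iota add0n ltnS andbC.
  have eqX : size [seq x <- X | x <= N] + size hi = size X.
    rewrite -(count_predC (fun x => x <= N) X) !size_filter; congr addn.
    by apply: eq_count => x; rewrite /= ltnNge.
  have := count_predC (mem X) (iota 0 N.+1).
  rewrite size_iota -!size_filter -eq_lo -/free => eqN.
  by move: X_size; rewrite -eqN -eqX leq_add2l.
pose f x := if x <= N then x else nth 0 free (index x hi).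
have f_hi x : x \in X -> (x <= N) = false ->
    f x \in free /\ f x = nth 0 free (index x hi).
  move=> xX xN; rewrite /f xN; split=> //; apply/mem_nth/leq_trans/hi_free.
  by rewrite index_mem mem_filter xX ltnNge xN.
have f_free x : f x \in free -> f x < N.+1 /\ f x \notin X.
  by rewrite mem_filter mem_iota add0n => /andP[-> /andP[_ ->]].
have f_lt x : x \in X -> f x < N.+1.
  move=> xX; case xN: (x <= N); first by rewrite /f xN ltnS.
  by have [/f_free[]] := f_hi x xX xN.
have f_inj : {in X &, injective f}.
  move=> x y xX yX; case xN: (x <= N); case yN: (y <= N).
  - by rewrite /f xN yN.
  - have [/f_free[_ fy] _] := f_hi y yX yN.
    by move=> e; move: fy; rewrite -e /f xN xX.
  - have [/f_free[_ fx] _] := f_hi x xX xN.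
    by move=> e; move: fx; rewrite e /f yN yX.
  have [_ ->] := f_hi x xX xN; have [_ ->] := f_hi y yX yN.
  have hi_mem z : z \in X -> (z <= N) = false -> z \in hi.
    by move=> zX zN; rewrite mem_filter zX ltnNge zN.
  have lt z : z \in hi -> index z hi < size free.
    by rewrite -index_mem => /leq_trans; apply.
  have xh := hi_mem x xX xN; have yh := hi_mem y yX yN.
  move/eqP; rewrite nth_uniq ?lt // => /eqP e.
  by rewrite -(nth_index 0 xh) e nth_index.
exists (fun x => inord (f x)); split=> [x y xX yX|j].
  by move/(congr1 val); rewrite /= !inordK ?f_lt //; exact: f_inj.
by rewrite /f -ltnS ltn_ord inord_val.
Qed.

(** * Isolating formulas and co-atoms *)

Section Isolation.
Variables (S : signature) (n : nat) (T : set (fmla S 'I_n.+1)).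

Lemma Fm_neq0 (a : Fm T) : a != (\bot)%O ->
  exists M, model T M /\ exists s : 'I_n.+1 -> M, satisfies s (repr a).
Proof.
move=> a0; apply: contrapT => H; move/eqP: a0; apply.
apply: Fm_ext => M MT s; rewrite (sat_bot MT) propeqE; split=> // sa.
by apply: H; exists M; split=> //; exists s.
Qed.

Lemma satisfies_neq0 (M : structure S) (MT : model T M) (s : 'I_n.+1 -> M) phi :
  satisfies s phi -> cls T phi != (\bot)%O.
Proof.
rewrite -(repr_cls MT) => sp; apply/eqP => e.
by move: sp; rewrite e (sat_bot MT).
Qed.

Lemma le_satisfies (a b : Fm T) M (MT : model T M) (s : 'I_n.+1 -> M) :
  (a <= b)%O -> satisfies s (repr a) -> satisfies s (repr b).
Proof. by move=> /eqP ab; rewrite -{1}ab (sat_meet MT) => -[]. Qed.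

(** Renamed into the language, [psi] lies above an atom [a]. It would have to imply the co-atom
    complementary to [a], which fails wherever [a] holds. *)
Lemma isolates_nvars psi : atomic_theory T -> isolates T psi -> n.+1 < nvars psi.
Proof.
move=> T_atomic [[M [MT [s sM]]] iso]; rewrite ltnNge; apply/negP => le.
have [g [g_inj gid]] := fold_variables (undup_uniq (vars psi)) le.
have g_inj' : {in vars psi &, injective g}.
  by move=> x y xv yv; apply: g_inj; rewrite mem_undup.
pose s1 y := if [pick i : seq_sub (vars psi) | g (val i) == y] is Some i
  then s (val i) else s 0.
have s1s : forall x, x \in vars psi -> s x = s1 (g x).
  move=> x xv; rewrite /s1; case: pickP => [i /eqP e|/(_ (SeqSub xv))].
    by congr s; apply: g_inj' => //; exact: (valP i).
  by rewrite eqxx.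
have gpsi0 : cls T (ren g psi) != (\bot)%O.
  exact: satisfies_neq0 MT s1 _ (proj1 (sat_ren _ g_inj' s1s) sM).
have [a a_atom a_le] := T_atomic _ gpsi0.
have := proj1 a_atom; rewrite lt0x => /Fm_neq0[M' [M'T [s2 s2a]]].
have /(_ M' M'T (s2 \o g)) /= :
    entails T (Imp psi (ren (@nat_of_ord n.+1) (repr (~` a)%O))).
  by apply: iso; rewrite /Gamma /= /cls reprK; exact: atom_coatom_compl.
have s2psi : satisfies s2 (ren g psi).
  by rewrite -(repr_cls M'T); exact: le_satisfies M'T _ a_le s2a.
have psi2 : satisfies (s2 \o g) psi.
  by refine (proj2 (sat_ren _ g_inj' _) s2psi).
apply; split=> // na.
have : satisfies s2 (repr (~` a)%O).
  refine (proj2 (sat_ren _ _ _) na) => [x y _ _|x _]; first exact: val_inj.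
  by rewrite /= gid.
by rewrite (sat_compl M'T).
Qed.

End Isolation.

(** * The theory of a structure *)

Section TheoryOf.
Variables (S : signature) (n : nat) (M : structure S).
Implicit Types (phi psi : fmla S 'I_n.+1) (s t : 'I_n.+1 -> M).

Definition theory_of : set (fmla S 'I_n.+1) :=
  [set phi | sentence phi /\ forall s, satisfies s phi].

Notation T := theory_of.
Implicit Types a b : Fm T.

Lemma model_theory_of : model T M.
Proof. by move=> phi []. Qed.

Let MT := model_theory_of.

Definition exists_all phi : fmla S 'I_n.+1 := foldr (@Ex S 'I_n.+1) phi (enum 'I_n.+1).

Lemma satisfies_foldr_Ex (N : structure S) (s : 'I_n.+1 -> N) phi (xs : seq 'I_n.+1) :
  satisfies s (foldr (@Ex S 'I_n.+1) phi xs) <->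
  exists2 t, satisfies t phi & forall x, x \notin xs -> t x = s x.
Proof.
elim: xs s => [|x xs IH] s /=.
  split=> [|[t tp ts]]; first by exists s.
  by rewrite -(_ : t = s) //; apply/funext => x; exact: ts.
split=> [[u [_ us /IH[t tp tu]]]|[t tp ts]].
  exists t => // y; rewrite inE negb_or => /andP[yx yxs].
  by rewrite tu // us.
exists (fun y => if y == x then t x else s y); split=> // [y /negPf -> //|].
apply/IH; exists t => // y yxs; case: eqP => [->//|/eqP yx].
by rewrite ts // inE negb_or yx.
Qed.

Lemma satisfies_exists_all (N : structure S) (s : 'I_n.+1 -> N) phi :
  satisfies s (exists_all phi) <-> exists t : 'I_n.+1 -> N, satisfies t phi.
Proof.
rewrite /exists_all; split=> [/satisfies_foldr_Ex[t tp _]|[t tp]]; first by exists t.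
by apply/satisfies_foldr_Ex; exists t => // x; rewrite mem_enum.
Qed.

Lemma fv_foldr_Ex phi (xs : seq 'I_n.+1) :
  fv (foldr (@Ex S 'I_n.+1) phi xs) = [seq y <- fv phi | y \notin xs].
Proof.
elim: xs => [|x xs IH] /=; first by rewrite filter_predT.
rewrite IH -filter_predI; apply: eq_filter => y.
by rewrite /= inE negb_or.
Qed.

Lemma sentence_exists_all phi : sentence (exists_all phi).
Proof.
rewrite /sentence fv_foldr_Ex -(filter_pred0 (fv phi)).
by apply: eq_filter => y; rewrite mem_enum.
Qed.

(** The universal closure of [phi] is a sentence of the theory. *)
Lemma entails_theory_of phi : (forall s, satisfies s phi) -> entails T phi.
Proof.
move=> valid N NT s; apply: contrapT => ns.
have /NT/(_ s) : T (Neg (exists_all (Neg phi))).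
  split; first exact: sentence_exists_all.
  by move=> t /satisfies_exists_all[u]; apply; exact: valid.
by apply; apply/satisfies_exists_all; exists s.
Qed.

Lemma cls_eqM phi psi :
  (forall s, satisfies s phi <-> satisfies s psi) -> cls T phi = cls T psi.
Proof.
move=> eqv; apply/cls_eq/entails_theory_of => s; have [h1 h2] := eqv s.
by split=> -[] h; apply; [exact: h1|exact: h2].
Qed.

Lemma satisfies_cls s phi : satisfies s (repr (cls T phi)) = satisfies s phi.
Proof. exact: (repr_cls MT). Qed.

Lemma Fm_extM a b :
  (forall s, satisfies s (repr a) <-> satisfies s (repr b)) -> a = b.
Proof. by move=> /cls_eqM; rewrite /cls !reprK. Qed.

Lemma Fm_neq0M a : a != (\bot)%O -> exists s, satisfies s (repr a).
Proof.
move=> a0; apply: contrapT => H; move/eqP: a0; apply; apply: Fm_extM => s.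
by rewrite (sat_bot MT); split=> // sa; apply: H; exists s.
Qed.

Lemma cyl_cls i phi : cyl i (cls T phi) = cls T (Ex i phi).
Proof.
apply: Fm_extM => s; rewrite satisfies_cls (sat_cyl MT).
split=> [[t [ts]]|[t [_ ts tp]]]; first by rewrite satisfies_cls; exists t.
by exists t; rewrite satisfies_cls.
Qed.

Lemma compl_cls phi : (~` cls T phi)%O = cls T (Neg phi).
Proof. by apply: Fm_extM => s; rewrite satisfies_cls (sat_compl MT) satisfies_cls. Qed.

Lemma cls_top phi : (forall s, satisfies s phi) -> cls T phi = (\top)%O.
Proof.
by move=> valid; apply: Fm_extM => s; rewrite satisfies_cls (sat_top MT).
Qed.

(** A congruence identifying distinct elements identifies some nonzero [z] with bottom.
    Cylindrifying [z] along all variables gives top, so top and bottom are identified. *)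
Lemma complete_theory_of : complete_theory T.
Proof.
have [x0] := dom_inhabited M.
split=> [e|E Econg].
  have := sat_top MT (fun=> x0); rewrite -[fm_top T]/(\top)%O -e.
  by rewrite (sat_bot MT) => ->.
have [|neq] := pselect (forall x y, E x y -> x = y); [by left|right].
have {neq} [x [y [Exy [s [sx sy]]]]] : exists x y, E x y /\
    exists s, satisfies s (repr x) /\ ~ satisfies s (repr y).
  apply: contrapT => H; apply: neq => x y Exy; apply: Fm_extM => s.
  split=> h; apply: contrapT => h'; apply: H; [exists x, y|exists y, x]; split=> //.
  - by exists s.
  - exact: congr_sym.
  - by exists s.
pose z := (x `&` ~` y)%O.
have Ez : E z (\bot)%O.
  by rewrite -(meetxC y); apply: congr_meet Exy _ => //; exact: congr_refl.
have Eall (w : Fm T) (xs : seq 'I_n.+1) :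
    E w (\bot)%O -> E (foldr cyl w xs) (\bot)%O.
  move=> Ew; elim: xs => //= i xs IH; rewrite -(cyl0 i); exact: congr_cyl.
have cls_all phi (xs : seq 'I_n.+1) :
    foldr cyl (cls T phi) xs = cls T (foldr (@Ex S 'I_n.+1) phi xs).
  by elim: xs => //= i xs ->; exact: cyl_cls.
have := Eall z (enum 'I_n.+1) Ez; rewrite -[z]reprK cls_all cls_top => [E10|t].
  have E0 w : E w (\bot)%O.
    by rewrite -{1}[w]meetx1 -(meetx0 w); apply: congr_meet => //; exact: congr_refl.
  move=> u v; apply: congr_trans (E0 u) _ => //; exact: congr_sym.
apply/satisfies_exists_all; exists s.
by rewrite (sat_meet MT) (sat_compl MT).
Qed.

Definition complete_formula (s : 'I_n.+1 -> M) phi : Prop :=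
  satisfies s phi /\
  forall t, satisfies t phi -> forall psi, satisfies s psi <-> satisfies t psi.

(** The class of a complete formula is an atom: a nonzero element below it holds at some tuple,
    hence at every tuple satisfying the formula. *)
Lemma atomic_theory_of :
  (forall s phi, satisfies s phi -> exists t chi,
     satisfies t phi /\ complete_formula t chi) ->
  atomic_theory T.
Proof.
move=> H x /Fm_neq0M[s /H[t [chi [tx [tchi chi_c]]]]].
have chi_le (y : Fm T) : satisfies t (repr y) -> (cls T chi <= y)%O.
  move=> ty; apply/eqP; apply: Fm_extM => u.
  rewrite (sat_meet MT) satisfies_cls; split=> [[]//|uchi]; split=> //.
  by apply/(chi_c _ uchi).
exists (cls T chi); last exact: chi_le.
split=> [|y]; first by rewrite lt0x; exact: satisfies_neq0 MT t _ tchi.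
rewrite lt_neqAle => /andP[y_neq y_le]; apply/eqP; apply: contraT.
move=> /Fm_neq0M[u uy]; have uchi := le_satisfies MT y_le uy.
rewrite satisfies_cls in uchi.
case/negP: y_neq; apply/eqP/le_anti; rewrite y_le chi_le //.
by apply/(chi_c _ uchi).
Qed.

End TheoryOf.

(** * The theory of the generic graph *)

Section GenericTheory.
Variable k : nat.
Notation n := k.+3.

Definition symbol : Type := (nat + (bool + bool * nat))%type.

Definition graph_sig : signature :=
  Signature (fun r : symbol => if r is inl _ then 1 else k.+2).

Definition graph_interp (r : graph_sig) : set ('I_(arity r) -> nat) :=
  match r return set ('I_(@arity graph_sig r) -> nat) with
  | inl sigma => [set t | srt k (t ord0) = sigma]
  | inr v => [set t | col t = Some v]
  end.

Definition graph : structure graph_sig :=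
  @Structure graph_sig nat (inhabits 0) graph_interp.

Definition of_sort (sigma : nat) (i : 'I_n) : fmla graph_sig 'I_n :=
  @Rel graph_sig _ (inl sigma) (fun=> i).

Definition of_colour (v : bool + bool * nat) (l : 'I_k.+2 -> 'I_n) :
  fmla graph_sig 'I_n := @Rel graph_sig _ (inr v) l.

(** This is the greatest label index mentioned, not a quantifier depth. *)
Fixpoint depth (phi : fmla graph_sig 'I_n) : nat :=
  match phi with
  | Rel (inr (inr (_, i))) _ => i
  | Neg p => depth p
  | And p q => maxn (depth p) (depth q)
  | Ex _ p => depth p
  | _ => 0
  end.

Lemma similar_sym N s s' : similar N s s' -> @similar k N s' s.
Proof.
by case=> h1 h2 h3; split=> *; rewrite ?h1 ?h2 // near_sym.
Qed.

Lemma near_eq N al be v : (if v is inr (_, i) then i else 0) <= N ->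
  near N al be -> al = Some v -> be = Some v.
Proof.
move=> vN /orP[/eqP<-//|/andP[h _] e]; move: h; rewrite e.
by case: v vN {e} => [//|[x i]] /= iN; rewrite ltnNge iN.
Qed.

(** Similarity is a back-and-forth system in which [N] does not decrease, so one bound serves all
    nested quantifiers. *)
Lemma similar_satisfies N phi (s s' : 'I_n -> graph) :
  depth phi <= N -> similar N s s' -> satisfies s phi -> satisfies s' phi.
Proof.
rewrite /satisfies; elim: phi s s' => [r l|x y||p IH|p IHp q IHq|x p IH] s s' /=.
- case: r l => [sigma|v] l vN [_ s_srt s_col] /=; first by rewrite -s_srt.
  apply: near_eq (s_col l); by case: v l vN => [|[? ?]].
- by move=> _ [s_eq _ _] /eqP; rewrite s_eq => /eqP.
- by [].
- by move=> pN ss'; apply: contra_not; apply/IH/similar_sym.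
- rewrite geq_max => /andP[pN qN] ss' [sp sq]; split.
    exact: IHp ss' sp.
  exact: IHq ss' sq.
- move=> pN ss' [t [_ ts tp]].
  have tE : t = upd s x (t x).
    by apply/funext => y; rewrite /upd; case: eqP => [->//|/eqP /ts].
  have [u' [sim _]] := back_and_forth x (t x) ss'.
  exists (upd s' x u'); split=> //; last by apply: IH pN sim _; rewrite -tE.
  by move=> y /negPf yx; rewrite /upd yx.
Qed.

(** The construction starts from a constant tuple, standard since its faces are improper, and
    installs the entries of [s] one at a time. *)
Lemma standard_similar N (s : 'I_n -> nat) :
  exists s', similar N s s' /\ @standard k s'.
Proof.
have [s' [sim std]] : exists s', similar N
    (fun j => if j \in enum 'I_n then s j else s p0) s' /\ @standard k s'.
  elim: (enum 'I_n) => [|x xs [s' [sim std]]].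
    exists (fun=> s p0); split=> [|l]; first by split=> // l; exact: near_refl.
    by rewrite col_improper // /face_sorts /= ltnn.
  have [u' [sim' std']] := back_and_forth x (s x) sim.
  exists (upd s' x u'); split; last exact: std'.
  rewrite (_ : (fun j => _) = upd (fun j => if j \in xs then s j else s p0) x (s x)) //.
  by apply/funext => j; rewrite inE /upd; case: eqP => [->|].
exists s'; split=> //.
by rewrite (_ : s = (fun j => if j \in enum 'I_n then s j else s p0)) //;
  apply/funext => j; rewrite mem_enum.
Qed.

Definition conj_all (J : finType) (F : J -> fmla graph_sig 'I_n) :
  fmla graph_sig 'I_n := foldr (fun j => And (F j)) (Top _ _) (enum J).

Lemma satisfies_conj_all (s : 'I_n -> graph) (J : finType) (F : J -> fmla graph_sig 'I_n) :
  satisfies s (conj_all F) <-> forall j, satisfies s (F j).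
Proof.
rewrite /conj_all.
suff H (js : seq J) : satisfies s (foldr (fun j => And (F j)) (Top _ _) js) <->
    forall j, j \in js -> satisfies s (F j).
  by rewrite H; split=> h j; [apply: (h j); rewrite mem_enum|move=> _; exact: h].
elim: js => [|j js [IH1 IH2]]; first by split=> // _ [].
split=> [[sj /IH1 sjs] i|h].
  by rewrite inE => /orP[/eqP->|/sjs].
have hj : satisfies s (F j) by apply: h; rewrite inE eqxx.
by split=> //; apply: IH2 => i ijs; apply: h; rewrite inE ijs orbT.
Qed.

(** Faces of limit colour contribute only [Top], so the description is complete only for standard
    tuples. *)
Definition diagram (s : 'I_n -> nat) : fmla graph_sig 'I_n :=
  And (conj_all (fun ij : 'I_n * 'I_n =>
         if s ij.1 == s ij.2 then Eq ij.1 ij.2 else Neg (Eq ij.1 ij.2)))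
  (And (conj_all (fun i => of_sort (srt k (s i)) i))
       (conj_all (fun l : {ffun 'I_k.+2 -> 'I_n} =>
         if col (s \o l) is Some v then of_colour v l else Top _ _))).

Lemma satisfies_diagram (s : 'I_n -> graph) : satisfies s (diagram s).
Proof.
split; [|split]; apply/satisfies_conj_all => x.
- by case: eqP.
- by [].
- by case e: (col _) => [v|]; [exact: e|case].
Qed.

Lemma diagram_similar N (s : 'I_n -> nat) (t : 'I_n -> graph) :
  standard s -> satisfies t (diagram s) -> similar N s t.
Proof.
move=> std [/satisfies_conj_all t_eq [/satisfies_conj_all t_srt /satisfies_conj_all t_col]].
split=> [i j|i|l].
- have := t_eq (i, j); rewrite /satisfies /=; case: (s i =P s j) => /= _ ? //.
    by apply/esym/eqP.
  by apply/esym/eqP.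
- exact: esym (t_srt i).
- have := t_col (finfun l); have := std (finfun l).
  have -> : s \o finfun l = s \o l by apply/funext => x; rewrite /= ffunE.
  case e: (col _) => [v|//] _; rewrite /satisfies /= => h.
  suff -> : col (t \o l) = Some v by exact: near_refl.
  by rewrite -h; congr col; apply/funext => x; rewrite /= ffunE.
Qed.

(** All colours being fixed exactly, a tuple satisfying the diagram is similar to [s] for every [N],
    in particular for [depth psi]. *)
Lemma diagram_complete (s : 'I_n -> graph) :
  standard s -> complete_formula s (diagram s).
Proof.
move=> std; split=> [|t tD psi]; first exact: satisfies_diagram.
have sim := diagram_similar (depth psi) std tD.
split; first exact: similar_satisfies (leqnn _) sim.
exact: similar_satisfies (leqnn _) (similar_sym sim).
Qed.

Definition graph_theory : set (fmla graph_sig 'I_n) := @theory_of _ k.+2 graph.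

Lemma graph_theory_standard (s : 'I_n -> graph) phi : satisfies s phi ->
  exists t : 'I_n -> graph, standard t /\ satisfies t phi.
Proof.
move=> sp; have [t [sim std]] := standard_similar (depth phi) s.
by exists t; split=> //; apply: similar_satisfies sim sp.
Qed.

Lemma atomic_graph_theory : atomic_theory graph_theory.
Proof.
apply: atomic_theory_of => s phi /graph_theory_standard[t [std tp]].
by exists t, (diagram t); split=> //; exact: diagram_complete.
Qed.

Lemma countable_graph_theory : countable_theory graph_theory.
Proof.
split; last by move=> phi [].
exact: (@countableP (nat + (bool + bool * nat))%type).
Qed.

End GenericTheory.

Arguments graph_theory : clear implicits.

(** * Square representations *)

Lemma sort_inhabited k sigma : exists u, srt k u = sigma.
Proof.
have [u _ ut] := task_of_unbounded
  ((sigma, p0, [ffun=> 0], [ffun=> None]) : task k) 0.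
by exists u; rewrite /srt ut.
Qed.

(** A proper tuple with a single apex starts with two base nodes, and then no triangle rule applies.
    Hence joining the new apex to both is a valid request. *)
Lemma cone_extension k (t : 'I_k.+3 -> nat) sigma : 1 < sigma < 6 ->
  srt k (t p0) = 0 -> srt k (t p1) = 1 ->
  (forall j : 'I_k.+3, 2 < j -> srt k (t j) = j + 3) ->
  exists u, [/\ srt k u = sigma, col (upd t p2 u \o lift p1) = white true
    & col (upd t p2 u \o lift p0) = white true].
Proof.
move=> /andP[s1 s6] t0 t1 tz.
have srtE u j : srt k u = sigma -> srt k (upd t p2 u j) =
    match val j with 0 => 0 | 1 => 1 | 2 => sigma | i => i + 3 end.
  move=> us; rewrite /upd; case: eqP => [->//|/eqP].
  by case: (ord3P j) => [->|->|->|j3] // _; rewrite tz //; case: j j3 => [[|[|[|j]]] h].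
have [||u [us _ u_col]] := @extension k t p2 sigma (fun=> white true).
- by [].
- move=> u g us _ /and4P[s01 s12 s26 _].
  suff [low0 low1] : srt k ((upd t p2 u \o g) p0) < 2 /\
      srt k ((upd t p2 u \o g) p1) < 2.
    by rewrite /coloured_triangle /triangle low0 low1.
  move: s01 s12 s26; rewrite /= !srtE //.
  by case: (val (g p0)) (val (g p1)) (val (g p2)) => [|[|[|?]]] [|[|[|?]]] [|[|[|?]]];
    split; lia.
have us_sorts : tuple_sorts (upd t p2 u).
  rewrite /tuple_sorts !srtE //= s1 s6; apply/forallP => j; apply/implyP.
  by rewrite srtE //; case: j => [[|[|[|j]]] h].
exists u; split=> //; apply: u_col; try exact: tuple_sorts_face.
  by apply/codomP; exists q1; apply: val_inj.
by apply/codomP; exists q1; apply: val_inj.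
Qed.

Section Representation.
Variable k : nat.
Notation n := k.+3.
Notation T := (graph_theory k).
Variables (M : Type) (V : set ('I_n -> M)) (f : Fm T -> set ('I_n -> M)).
Hypothesis frep : relativized_rep V f.
Hypothesis Gamma_omitted : ~ Gamma_realized V f.

Definition holds (s : 'I_n -> M) (phi : fmla (graph_sig k) 'I_n) : Prop :=
  f (cls T phi) s.

(* As [s] lies outside some co-atom, its type is generated by an atom, hence realized
   by a standard tuple of the graph. *)
Lemma twin s : V s -> exists t : 'I_n -> graph k,
  standard t /\ forall phi, holds s phi <-> satisfies t phi.
Proof.
move=> Vs.
have [phi Gphi nphi] : exists2 phi, Gamma T phi & ~ f (cls T phi) s.
  apply: contrapT => H; apply: Gamma_omitted; exists s; split=> // phi Gphi.
  by apply: contrapT => h; apply: H; exists phi.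
have [phi_lt phi_max] := Gphi.
have : (~` cls T phi)%O != (\bot)%O.
  by apply: contraTneq phi_lt => e; rewrite -[cls T phi]complK e compl0 ltxx.
move=> /Fm_neq0M[t0]; rewrite compl_cls satisfies_cls.
move=> /graph_theory_standard[t [std tphi]]; exists t; split=> //.
have sub psi : satisfies t psi -> holds s psi.
  move=> tpsi; have : (cls T phi < cls T phi `|` cls T psi)%O.
    rewrite lt_neqAle leUl andbT; apply/eqP => e; apply: tphi.
    have MT := @model_theory_of _ k.+2 (graph k).
    suff : satisfies t (repr (cls T phi)) by rewrite satisfies_cls.
    by rewrite e (sat_join MT); right; rewrite satisfies_cls.
  move=> /phi_max e; have : V s := Vs.
  by rewrite -(rep_top frep) -e (rep_join frep) => -[].
move=> psi; split=> [spsi|/sub//]; apply: contrapT => ntpsi.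
have : holds s (Neg psi) by apply: sub.
by rewrite /holds -compl_cls (rep_compl frep) => -[_].
Qed.

Lemma holds_Ex s i phi :
  holds s (Ex i phi) <-> V s /\ exists2 t, holds t phi & agree_off i t s.
Proof. by rewrite /holds -cyl_cls (rep_cyl frep). Qed.

Lemma holds_V s phi : holds s phi -> V s.
Proof.
rewrite /holds -(rep_top frep) -(joinxC (cls T phi)) (rep_join frep).
by left.
Qed.

Lemma holds_valid s phi : V s -> (forall t : 'I_n -> graph k, satisfies t phi) ->
  holds s phi.
Proof. by move=> Vs valid; rewrite /holds cls_top // (rep_top frep). Qed.

Lemma holds_Eq s i j : holds s (Eq i j) <-> V s /\ s i = s j.
Proof.
rewrite /holds.
by have -> : f (cls T (Eq i j)) = [set s | V s /\ s i = s j] := rep_diag frep i j.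
Qed.

Lemma holds_off_fv s s' i phi : i \notin fv phi -> V s' -> agree_off i s s' ->
  holds s phi -> holds s' phi.
Proof.
move=> i_fv Vs' ss' sphi; have : holds s' (Ex i phi).
  by apply/holds_Ex; split=> //; exists s.
rewrite /holds (@cls_eqM _ _ (graph k) (Ex i phi) phi) // => t.
split=> [[u [_ ut]]|tphi]; last by exists t.
apply: sat_fv => x xf; apply: ut; apply: contraNneq i_fv => <-.
by [].
Qed.

(** Entries are exchanged one at a time; within a clique all intermediate tuples stay in [V]. *)
Lemma holds_fv (C : set M) s s' phi : clique V C ->
  (forall i, C (s i)) -> (forall i, C (s' i)) ->
  (forall i, i \in fv phi -> s i = s' i) -> holds s phi -> holds s' phi.
Proof.
move=> VC Cs Cs' ss' sphi.
suff H (xs : seq 'I_n) : holds (fun j => if j \in xs then s' j else s j) phi.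
  have -> : s' = (fun j => if j \in enum 'I_n then s' j else s j).
    by apply/funext => j; rewrite mem_enum.
  exact: H.
elim: xs => [//|x xs IH].
have [xf|xf] := boolP (x \in fv phi).
  rewrite (_ : (fun j => _) = (fun j => if j \in xs then s' j else s j)) //.
  apply/funext => j; rewrite inE; case: eqP => // ->; case: ifP => // _.
  exact/esym/ss'.
apply: holds_off_fv xf _ _ IH => [|j jx].
  by apply: VC => j; case: ifP.
by rewrite inE (negPf jx).
Qed.

(** [V] is nonempty since [f] separates bottom from top. Validity of [Ex x (Eq x p0)] lets each
    entry be replaced in turn by [s p0]. This gives a first, one-point clique. *)
Lemma V_const : exists a, V (fun=> a).
Proof.
have [s Vs] : exists s, V s.
  apply: contrapT => H.
  have [e _] := @complete_theory_of _ k.+2 (graph k).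
  apply/e/(rep_inj frep); rewrite (rep_bot frep) (rep_top frep).
  by apply/esym/seteqP; split=> // s Vs; apply: H; exists s.
exists (s p0).
suff H (xs : seq 'I_n) : V (fun j => if j \in xs then s p0 else s j).
  have := H (enum 'I_n); congr V; apply/funext => j; by rewrite mem_enum.
elim: xs => // x xs IH; have [ex|xp] := eqVneq x p0.
  rewrite (_ : (fun j => _) = (fun j => if j \in xs then s p0 else s j)) //.
  by apply/funext => j; rewrite inE ex; case: eqP => // ->; case: ifP.
have /holds_Ex[_ [t tE ts]] :
    holds (fun j => if j \in xs then s p0 else s j) (Ex x (Eq x p0)).
  apply: holds_valid => // t; exists (fun j => if j == x then t p0 else t j).
  split=> // [j /negPf ->//|/=]; rewrite eqxx eq_sym (negPf xp) //.
have [Vt txp] := proj1 (holds_Eq _ _ _) tE.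
rewrite (_ : (fun j => _) = t) //; apply/funext => j; rewrite inE.
case: eqP => [->|/eqP jx /=]; last by rewrite ts.
by rewrite txp ts 1?eq_sym //; case: ifP.
Qed.

(** * Sorts and colours inside a clique *)

Section Clique.
Variables (C : set M) (VC : clique V C) (z : nat -> M) (Cz : forall i, C (z i)).

Definition arrange (x y w : M) (j : 'I_n) : M :=
  match val j with 0 => x | 1 => y | 2 => w | i.+3 => z i end.

Lemma arrange_in x y w : C x -> C y -> C w -> forall j, C (arrange x y w j).
Proof. by move=> Cx Cy Cw [[|[|[|j]]] h] //; exact: Cz. Qed.

Definition has_sort (sigma : nat) (x : M) : Prop :=
  holds (fun=> x) (of_sort sigma p0).

(* The third place is a dummy, filled with [y] so that the tuple stays in the clique. *)
Definition coloured (v : bool + bool * nat) (x y : M) : Prop :=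
  holds (arrange x y y) (of_colour v (lift p2)).

(** On the constant tuple with value [s i] all variables are equal, so the atom can be moved from
    [i] to [p0]. *)
Lemma holds_of_sort s sigma i : (forall j, C (s j)) ->
  holds s (of_sort sigma i) <-> has_sort sigma (s i).
Proof.
move=> Cs; have Vc : V (fun=> s i) by apply: VC.
have [t [_ tE]] := twin Vc.
have tp : t i = t p0.
  by apply: (proj1 (tE (Eq i p0))); apply/holds_Eq; split.
have -> : has_sort sigma (s i) <-> holds (fun=> s i) (of_sort sigma i).
  by rewrite /has_sort !tE /satisfies /= tp.
have fvE j : j \in fv (of_sort sigma i) -> j = i by case/codomP=> ? ->.
by split; apply: (holds_fv VC) => // j /fvE ->.
Qed.

Lemma holds_move s i j phi psi : (forall j, C (s j)) -> s i = s j ->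
  (forall t : 'I_n -> graph k, t i = t j -> satisfies t phi <-> satisfies t psi) ->
  holds s phi <-> holds s psi.
Proof.
move=> Cs sij eqv; have [t [_ tE]] := twin (VC Cs).
rewrite !tE; apply/eqv/(proj1 (tE (Eq i j))).
by apply/holds_Eq; split=> //; exact: VC.
Qed.

Lemma holds_face v (o : 'I_n) s s' : (forall j, C (s j)) -> (forall j, C (s' j)) ->
  (forall j, j != o -> s j = s' j) ->
  holds s (of_colour v (lift o)) <-> holds s' (of_colour v (lift o)).
Proof.
move=> Cs Cs' ss'.
have fvE j : j \in fv (of_colour v (lift o)) -> j != o.
  by case/codomP=> x ->; rewrite eq_sym neq_lift.
by split; apply: (holds_fv VC) => // j /fvE /ss'.
Qed.

Lemma face_eq (t : 'I_n -> graph k) (o o' : 'I_n) v : o < 3 -> o' < 3 ->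
  (forall j : 'I_k.+2, j < 2 -> t (lift o j) = t (lift o' j)) ->
  satisfies t (of_colour v (lift o)) <-> satisfies t (of_colour v (lift o')).
Proof.
move=> o3 o3' tE; rewrite /satisfies /=.
suff -> : t \o lift o = t \o lift o' by [].
apply/funext => j /=; have [/tE//|j2] := ltnP j 2.
by congr t; apply: val_inj; rewrite /= /bump !(leq_trans _ j2).
Qed.

Section Arranged.
Variables (x y w : M) (Cx : C x) (Cy : C y) (Cw : C w).

Lemma coloured01 v :
  holds (arrange x y w) (of_colour v (lift p2)) <-> coloured v x y.
Proof.
apply: holds_face => [||[[|[|[|j]]] h]] //; exact: arrange_in.
Qed.

(** An atom is moved to other variables by first copying an entry to the place it omits; the twin
    then has equal entries there, and the two faces coincide. *)
Lemma coloured02 v :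
  holds (arrange x y w) (of_colour v (lift p1)) <-> coloured v x w.
Proof.
have Cxww := arrange_in Cx Cw Cw.
rewrite (@holds_face v p1 _ (arrange x w w)) //.
- apply: (@holds_move _ p1 p2) => // t t12; apply: face_eq => // j.
  case: j => [[|[|j]]] h //= _; first by congr t; apply: val_inj.
  have -> : lift p1 (Ordinal h) = p2 by apply: val_inj.
  have -> // : lift p2 (Ordinal h) = p1 by apply: val_inj.
- exact: arrange_in.
- by move=> [[|[|[|j]]] h].
Qed.

Lemma coloured12 v :
  holds (arrange x y w) (of_colour v (lift p0)) <-> coloured v y w.
Proof.
have Cyww := arrange_in Cy Cw Cw.
have Cyyw := arrange_in Cy Cy Cw.
rewrite (@holds_face v p0 _ (arrange y y w)) //.
(* The tuple passes from [y], [y], [w] to [y], [w], [w], each time changing only the omitted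
   entry. *)
- rewrite (@holds_move _ p0 p1 _ (of_colour v (lift p1))) //.
    rewrite (@holds_face v p1 _ (arrange y w w)) //; last by move=> [[|[|[|j]]] h].
    apply: (@holds_move _ p1 p2) => // t t12; apply: face_eq => // j.
    case: j => [[|[|j]]] h //= _; first by congr t; apply: val_inj.
    have -> : lift p1 (Ordinal h) = p2 by apply: val_inj.
    by have -> // : lift p2 (Ordinal h) = p1 by apply: val_inj.
  move=> t t01; apply: face_eq => // j.
  case: j => [[|[|j]]] h //= _; last by congr t; apply: val_inj.
  have -> : lift p0 (Ordinal h) = p1 by apply: val_inj.
  by have -> // : lift p1 (Ordinal h) = p0 by apply: val_inj.
- exact: arrange_in.
- by move=> [[|[|[|j]]] h].
Qed.

Hypothesis z_sort : forall i, i < k -> has_sort (i + 6) (z i).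
Variables (p q r : nat) (px : has_sort p x) (qy : has_sort q y) (rw : has_sort r w).

Lemma arrange_twin : exists t : 'I_n -> graph k, [/\ standard t,
  forall phi, holds (arrange x y w) phi <-> satisfies t phi,
  [/\ srt k (t p0) = p, srt k (t p1) = q & srt k (t p2) = r]
  & forall j : 'I_n, 2 < j -> srt k (t j) = j + 3].
Proof.
have Cxyw := arrange_in Cx Cy Cw.
have [t [std tE]] := twin (VC Cxyw); exists t; split=> //.
  by split; apply: (proj1 (tE (of_sort _ _))); apply/holds_of_sort.
move=> j j2; apply: (proj1 (tE (of_sort _ _))); apply/holds_of_sort => //.
case: j j2 => [[|[|[|j]]] h] // _.
by rewrite (_ : Ordinal h + 3 = j + 6); [exact: z_sort|rewrite /=; lia].
Qed.

Hypotheses (pq : p < q) (qr : q < r) (r6 : r < 6).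

(** The triangle rule of the graph reaches the clique through the twin, whose standardness excludes
    the limit colour. *)
Lemma arrange_triangle : exists t : 'I_n -> graph k, [/\
  forall v, coloured v x y <-> col (t \o lift p2) = Some v,
  forall v, coloured v y w <-> col (t \o lift p0) = Some v,
  forall v, coloured v x w <-> col (t \o lift p1) = Some v,
  col (t \o lift p0) != None
  & triangle p q r (col (t \o lift p2)) (col (t \o lift p0)) (col (t \o lift p1))].
Proof.
have [t [std tE [tp tq tr] tz]] := arrange_twin; exists t; split.
- by move=> v; rewrite -coloured01 tE.
- by move=> v; rewrite -coloured12 tE.
- by move=> v; rewrite -coloured02 tE.
- exact: std.
have ts : tuple_sorts t.
  rewrite /tuple_sorts tp tq tr pq qr r6; apply/forallP => j; apply/implyP => j2.
  by rewrite tz.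
by have := col_triangle ts; rewrite /coloured_triangle tp tq tr.
Qed.

End Arranged.

Hypothesis z_sort : forall i, i < k -> has_sort (i + 6) (z i).

Section Apexes.
Variables (b : bool -> M) (c : nat -> M).
Hypotheses (Cb : forall j, C (b j)) (Cc : forall i, C (c i)).
Hypothesis b_sort : forall j : bool, has_sort j (b j).
Hypothesis c_sort : forall i, 1 < i < 6 -> has_sort i (c i).
Hypothesis bc : forall j i, 1 < i < 6 -> coloured (inl true) (b j) (c i).

(** The base node [b j] forbids white [j], and the limit colour cannot occur, so only a label
    remains. *)
Lemma apexes_labelled p q : 1 < p -> p < q -> q < 6 ->
  exists x i, coloured (inr (x, i)) (c p) (c q).
Proof.
move=> lp pq q6.
have p16 : 1 < p < 6 by rewrite lp (ltn_trans pq).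
have q16 : 1 < q < 6 by rewrite q6 (ltn_trans lp).
have fact (j : bool) :
    exists2 v, v <> inl j & forall v', coloured v' (c p) (c q) <-> v' = v.
  have jp : j < p by case: j; [|exact: ltn_trans lp].
  have [t [t01 t12 t02 tN tri]] := arrange_triangle (Cb j) (Cc p) (Cc q) z_sort
    (b_sort j) (c_sort p16) (c_sort q16) jp pq q6.
  case e: (col (t \o lift p0)) tN tri => [v|//] _.
  have -> : col (t \o lift p2) = white true by apply/t01/bc.
  have -> : col (t \o lift p1) = white true by apply/t02/bc.
  rewrite /triangle ltnS leq_b1 eqxx ltnNge lp /= => /eqP vj; exists v.
    by move=> vj'; apply: vj; rewrite vj'; case: (j).
  by move=> v'; rewrite t12 e; split=> [[]|->].
have [v v1 vP] := fact true; have [v' v0 vP'] := fact false.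
have e : v = v' by apply/vP'/vP.
subst v'; case: v v0 v1 vP {vP'} => [[]|[x i]] // _ _ vP.
by exists x, i; apply/vP.
Qed.

Lemma apexes_parity p q r x y w i j l : 1 < p -> p < q -> q < r -> r < 6 ->
  coloured (inr (x, i)) (c p) (c q) -> coloured (inr (y, j)) (c q) (c r) ->
  coloured (inr (w, l)) (c p) (c r) -> x (+) y (+) w = (r == 5).
Proof.
move=> lp pq qr r6 xpq yqr wpr.
have p16 : 1 < p < 6 by rewrite lp (ltn_trans pq) ?(ltn_trans qr).
have q16 : 1 < q < 6 by rewrite (ltn_trans lp) ?(ltn_trans qr).
have r16 : 1 < r < 6 by rewrite r6 (ltn_trans lp) ?(ltn_trans pq).
have [t [t01 t12 t02 _]] := arrange_triangle (Cc p) (Cc q) (Cc r) z_sort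
  (c_sort p16) (c_sort q16) (c_sort r16) pq qr r6.
rewrite (proj1 (t01 _) xpq) (proj1 (t12 _) yqr) (proj1 (t02 _) wpr).
by rewrite /triangle ltnNge lp /= => /andP[_ /eqP].
Qed.

(* Each of the six labels lies in two of the four triangles, so the four parities
   add up to 0; but exactly three of the triangles contain the node of sort 5. *)
Lemma no_four_apexes : False.
Proof.
have [x23 [? c23]] := @apexes_labelled 2 3 isT isT isT.
have [x24 [? c24]] := @apexes_labelled 2 4 isT isT isT.
have [x25 [? c25]] := @apexes_labelled 2 5 isT isT isT.
have [x34 [? c34]] := @apexes_labelled 3 4 isT isT isT.
have [x35 [? c35]] := @apexes_labelled 3 5 isT isT isT.
have [x45 [? c45]] := @apexes_labelled 4 5 isT isT isT.
have := @apexes_parity 2 3 4 _ _ _ _ _ _ isT isT isT isT c23 c34 c24.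
have := @apexes_parity 2 3 5 _ _ _ _ _ _ isT isT isT isT c23 c35 c25.
have := @apexes_parity 2 4 5 _ _ _ _ _ _ isT isT isT isT c24 c45 c25.
have := @apexes_parity 3 4 5 _ _ _ _ _ _ isT isT isT isT c34 c45 c35.
by move: x23 x24 x25 x34 x35 x45 {c23 c24 c25 c34 c35 c45}
  => [] [] [] [] [] [].
Qed.

End Apexes.

End Clique.

(** * Placing the nodes in a square model *)

Variables (m : edim) (h : nat -> ix m).
Hypothesis V_square : square V f m.
Hypothesis h_inj : {in gtn (k + 6) &, injective h}.

(* Only [e p] with [p < k + 6] matters; [e p] is to become a node of sort [p]. *)
Definition clique_seq (e : nat -> M) : Prop :=
  exists2 t : ix m -> M, cseq V t & e = t \o h.

Lemma clique_seq_range e : clique_seq e -> clique V (range e).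
Proof.
move=> [t Vt ->] a Ca; apply: Vt => j; have [i _ <-] := Ca j.
by exists (h i).
Qed.

Lemma move_clique_seq e (l : 'I_n -> nat) i phi : clique_seq e ->
  injective l -> (forall j, l j < k + 6) -> holds (e \o l) (Ex i phi) ->
  exists2 e', clique_seq e' & holds (e' \o l) phi /\
    forall p, p < k + 6 -> p != l i -> e' p = e p.
Proof.
move=> [t Vt ->] l_inj l_lt; rewrite /holds -cyl_cls => tl.
have hl_inj : injective (h \o l).
  by move=> x y /h_inj lxy; apply/l_inj/lxy; rewrite inE /= l_lt.
have [t' [Vt' t't ft']] := V_square Vt hl_inj tl.
exists (t' \o h); first by exists t'.
split=> // p pk pl; apply: t't; apply: contraNneq pl => /h_inj ->//.
by rewrite inE.
Qed.

Lemma clique_seq_sorts P : P <= k + 6 ->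
  exists2 e, clique_seq e & forall p, p < P -> has_sort p (e p).
Proof.
elim: P => [_|P IH lt].
  have [a Va] := V_const; exists (fun=> a) => //.
  exists (fun=> a) => // b Cb; rewrite (_ : b = fun=> a) //.
  by apply/funext => j; have [? _ <-] := Cb j.
have [e e_seq e_sort] := IH (ltnW lt).
(* This transposes [0] and [P]: variable 0 reads place [P], and [l] stays injective. *)
pose l (j : 'I_n) : nat :=
  if j == 0 :> nat then P else if j == P :> nat then 0 else j.
have l_inj : injective l.
  move=> [a ?] [b ?]; rewrite /l /= => eq_ab; apply: val_inj; move: eq_ab => /=.
  by case: (a =P 0); case: (a =P P); case: (b =P 0); case: (b =P P); lia.
have l_lt j : l j < k + 6.
  by rewrite /l; case: ifP => // _; case: ifP => _; [lia|have := ltn_ord j; lia].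
have Vel : V (e \o l).
  by apply: (clique_seq_range e_seq) => j; exists (l j).
have [|e' e'_seq [e'P e'e]] := @move_clique_seq e l p0 (of_sort P p0) e_seq l_inj l_lt.
  apply: holds_valid => // t; have [u us] := sort_inhabited k P.
  exists (fun j => if j == p0 then u else t j); split=> //.
  by move=> j /negPf ->.
exists e' => // p; rewrite ltnS leq_eqVlt => /orP[/eqP->|pP].
  have Ce' j : range e' ((e' \o l) j) by exists (l j).
  exact: (proj1 (holds_of_sort (clique_seq_range e'_seq) _ _ Ce') e'P).
rewrite e'e; first exact: e_sort.
  exact: ltn_trans pP lt.
by rewrite /l /= ltn_eqF.
Qed.

Definition params (e : nat -> M) (i : nat) : M := e (i + 6).

(** Each apex in turn is replaced by one joined to both base nodes, which [cone_extension] provides.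
    Two base nodes, four apexes and [k] parameters fill [k + 6] places, that is [n + 3]. *)
Lemma clique_seq_apexes I : I <= 6 ->
  exists2 e, clique_seq e & (forall p, p < k + 6 -> has_sort p (e p)) /\
    forall i (j : bool), 1 < i < I -> coloured (params e) (inl true) (e j) (e i).
Proof.
elim: I => [_|I IH lt].
  have [e e_seq e_sort] := clique_seq_sorts (leqnn _).
  by exists e => //; split=> // i j; rewrite ltn0 andbF.
have [e e_seq [e_sort e_col]] := IH (ltnW lt).
have [I1|I1] := leqP I 1.
  exists e => //; split=> // i j /andP[i1]; rewrite ltnS => iI; move: I1.
  by rewrite leqNgt (leq_trans i1).
(* These are the places of the base nodes, of apex [I] and of the parameters; the other apexes stay
   fixed when place [I] changes. *)
pose l (j : 'I_n) : nat :=
  match val j with 0 => 0 | 1 => 1 | 2 => I | i.+3 => i + 6 end.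
have l_inj : injective l.
  move=> [[|[|[|a]]] ?] [[|[|[|b]]] ?]; rewrite /l /= => eq_ab;
    apply: val_inj => /=; lia.
have l_lt j : l j < k + 6.
  by case: j => [[|[|[|a]]] ha]; rewrite /l /=; lia.
have el e' : e' \o l = arrange (params e') (e' 0) (e' 1) (e' I).
  by apply/funext => -[[|[|[|a]]] ha].
have C_of (e' : nat -> M) i : range e' (e' i) by exists i.
have I_lt : I < k + 6 by lia.
have VC := clique_seq_range e_seq.
have [t [_ tE [t0 t1 _] tz]] : exists t : 'I_n -> graph k, [/\ standard t,
    forall phi, holds (arrange (params e) (e 0) (e 1) (e I)) phi <-> satisfies t phi,
    [/\ srt k (t p0) = 0, srt k (t p1) = 1 & srt k (t p2) = I]
    & forall j : 'I_n, 2 < j -> srt k (t j) = j + 3].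
  apply: (arrange_twin VC); try by [move=> i; exact: C_of|exact: C_of].
  - by move=> i ik; apply: e_sort; rewrite ltn_add2r.
  - by apply: e_sort; lia.
  - by apply: e_sort; lia.
  - exact: e_sort.
have I16 : 1 < I < 6 by rewrite I1.
have [u [us u02 u12]] := cone_extension I16 t0 t1 tz.
pose cone := And (of_sort I p2) (And (of_colour (inl true) (lift p1))
  (of_colour (inl true) (lift p0)) : fmla (graph_sig k) 'I_n).
have [|e' e'_seq [e'_cone e'e]] := @move_clique_seq e l p2 cone e_seq l_inj l_lt.
  rewrite el; apply/tE; exists (upd t p2 u); split=> //.
  by move=> j /negPf jp; rewrite /upd jp.
have VC' := clique_seq_range e'_seq.
have e'0 : e' 0 = e 0 by apply: e'e => //; [lia|rewrite /l /= ltn_eqF // ltnW].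
have e'1 : e' 1 = e 1 by apply: e'e => //; [lia|rewrite /l /= ltn_eqF].
have e'z i : i < k -> params e' i = params e i.
  by move=> ik; apply: e'e; rewrite ?ltn_add2r // /l /=; lia.
have [t' [_ t'E]] := twin (holds_V e'_cone).
have /t'E [t'_I [t'_02 t'_12]] := e'_cone.
exists e' => //; split.
  move=> p pk; have [->|pI] := eqVneq p I; last by rewrite e'e //; exact: e_sort.
  have Ce' j : range e' ((e' \o l) j) by exists (l j).
  by apply: (proj1 (holds_of_sort VC' _ p2 Ce')); apply/t'E.
have e'I (j : bool) : coloured (params e') (inl true) (e' j) (e' I).
  have Cz i : range e' (params e' i) by exact: C_of.
  case: j; rewrite /=.
    rewrite -(coloured12 VC' Cz (C_of e' 0) (C_of e' 1) (C_of e' I)) -el.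
    exact/t'E.
  rewrite -(coloured02 VC' Cz (C_of e' 0) (C_of e' 1) (C_of e' I)) -el.
  exact/t'E.
move=> i j; have [->//|iI] := eqVneq i I.
rewrite ltnS [i <= I]leq_eqVlt (negPf iI) /= => iI'.
have := e_col i j iI'; rewrite /coloured.
have -> : arrange (params e') (e' j) (e' i) (e' i) =
    arrange (params e) (e j) (e i) (e i).
  have e'i : e' i = e i by apply: e'e => //; lia.
  have e'j : e' j = e j by case: j.
  apply/funext => -[[|[|[|a]]] ha]; rewrite /arrange //=.
  exact: e'z.
by [].
Qed.

Lemma square_contradiction : False.
Proof.
have [e e_seq [e_sort e_col]] := clique_seq_apexes (leqnn 6).
have C_of i : range e (e i) by exists i.
apply: (@no_four_apexes (range e) (clique_seq_range e_seq) (params e) _ _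
  (fun j : bool => e j) e).
- by move=> i; exact: C_of.
- by move=> i ik; apply: e_sort; rewrite ltn_add2r.
- by move=> j; exact: C_of.
- exact: C_of.
- by move=> j; apply: e_sort; rewrite (leq_ltn_trans (leq_b1 j)) //; lia.
- by move=> i /andP[_ i6]; apply: e_sort; lia.
- by move=> j i; exact: e_col.
Qed.

End Representation.

(** * Assembling the statement [Psi_f] *)

Lemma ix_nat_inj m q : 0 < q -> edim_ge m q ->
  exists h : nat -> ix m, {in gtn q &, injective h}.
Proof.
move=> q0; case: m => [[|m] /= qm|_]; last by exists id.
  by move: q0; rewrite ltnNge qm.
exists inord => x y /= xq yq /(congr1 val); rewrite /= !inordK //.
  exact: leq_trans yq qm.
exact: leq_trans xq qm.
Qed.

Lemma Psi_f_graph k m : edim_ge m (k.+3 + 3) -> Psi_f k.+3 k.+3 m.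
Proof.
have -> : k.+3 + 3 = k + 6 by lia.
move=> mk; exists (graph_sig k), (graph_theory k); split.
- exact: countable_graph_theory.
- exact: atomic_graph_theory.
- exact: complete_theory_of.
- move=> M V f [frep [fsq _]]; apply: contrapT => omitted.
  have [|h h_inj] := ix_nat_inj _ mk; first by lia.
  exact: (square_contradiction frep omitted fsq h_inj).
- by move=> psi; apply: isolates_nvars; exact: atomic_graph_theory.
Qed.

Theorem theorem3p6 (n : nat) (hn : (2 < n)%N) :
  Psi_f n n (Fin (n + 3)) /\
  (forall m : edim, edim_ge m (n + 3) -> Psi_f n n m).
Proof.
case: n hn => [|[|[|k]]] // _; split; last exact: Psi_f_graph.
by apply: Psi_f_graph => /=.
Qed.
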